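(* Let $H_t^{1/2}\in\mathbb{R}^{n\times d}$ with $n\ge d$, let $g_t\in\mathbb{R}^d$, and let $$\Delta_t^*=\big((H_t^{1/2})^TH_t^{1/2}\big)^{-1}g_t,\qquad\hat{\Delta}_{t,k}=\alpha_s\big((H_t^{1/2})^TS_{t,k}^TS_{t,k}H_t^{1/2}\big)^{-1}g_t,$$ where $\alpha_s\in\mathbb{R}$ is a step size scaling factor. For Gaussian sketches $S_{t,k}\in\mathbb{R}^{m\times n}$, assuming $H_t^{1/2}$ is full column rank, the variance $\mathbb{E}\big[\|H_t^{1/2}(\hat{\Delta}_{t,k}-\Delta_t^* )\|_2^2\big]$ is minimized when $\alpha_s$ is chosen as $\alpha_s=\frac{\theta_1}{\theta_2}$, whereas the bias $\mathbb{E}\big[H_t^{1/2}(\hat{\Delta}_{t,k}-\Delta_t^* )\big]$ is zero when $\alpha_s=\frac1{\theta_1}$, where $$\theta_1:=\frac{m}{m-d-1},\qquad\theta_2:=\frac{m^2(m-1)}{(m-d)(m-d-1)(m-d-3)}.$$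
   Context: The Hessian at iteration $t$ of Newton's method is $H_t=(H_t^{1/2})^TH_t^{1/2}$, where $H_t^{1/2}$ is the name of a (rectangular) $n\times d$ factor; $g_t$ is the gradient, $\Delta_t^*$ is the optimal Newton update direction and $\hat{\Delta}_{t,k}$ is the approximate direction returned by worker $k$ using the sketch $S_{t,k}$. A Gaussian sketch is a random matrix $S\in\mathbb{R}^{m\times n}$ with i.i.d. zero-mean Gaussian entries, scaled so that $\mathbb{E}[S^TS]=I_n$ (that is, entries $\mathcal{N}(0,1/m)$). Expectations are over the sketch only.
   Formalization: The formal theorem assumes m > d+3 for the variance claim and m > d+1 for the bias claim; without such bounds the claim fails (e.g. d=1, m=3, g nonzero: the variance at θ1/θ2 is infinite but finite at α_s=0). *)

(* Defs.v *)
From HB Require Import structures.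
From mathcomp Require Import all_boot all_order all_algebra.
From mathcomp Require Import all_classical all_reals all_analysis.

Set Implicit Arguments.
Unset Strict Implicit.
Unset Printing Implicit Defensive.

Import Order.TTheory GRing.Theory Num.Theory.
Import numFieldNormedType.Exports.

Local Open Scope classical_set_scope.
Local Open Scope ring_scope.

Section Probability.
Context (disp : measure_display) (Omega : measurableType disp) (R : realType).
Variable P : probability Omega R.

Definition mutually_independent (I : finType) (X : I -> {RV P >-> R}) : Prop :=
  forall (J : {set I}) (B : I -> set R),
    (forall i, i \in J -> measurable (B i)) ->
    P (\bigcap_(i in [set` J]) (X i @^-1` B i)) =
    (\prod_(i in J) P (X i @^-1` B i))%E.

(* The second parameter of [normal_prob] is the standard deviation.  The laws
   are compared on measurable sets only: on other sets, the values of
   [distribution] and [normal_prob] are meaningless. *)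
Definition has_normal_law (mu sigma : R) (X : {RV P >-> R}) : Prop :=
  forall A : set R, measurable A -> distribution P X A = normal_prob mu sigma A.

(* The variance is [1/m], so that [E[S^T S]] is the identity. *)
Definition gaussian_sketch (m n : nat) (S : 'I_m -> 'I_n -> {RV P >-> R})
    : Prop :=
  mutually_independent (fun ij : 'I_m * 'I_n => S ij.1 ij.2) /\
  forall i j, has_normal_law 0 (Num.sqrt (m%:R^-1)) (S i j).

Definition sketch_mx (m n : nat) (S : 'I_m -> 'I_n -> {RV P >-> R})
    (w : Omega) : 'M[R]_(m, n) := \matrix_(i, j) S i j w.

Definition expectation_cV (n : nat) (X : Omega -> 'cV[R]_n) : 'cV[\bar R]_n :=
  \col_i ('E_P[fun w => X w i ord0])%E.

End Probability.

(* The norm [`|v|] of the libraries on matrices is the sup norm. *)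
Definition l2norm (R : realType) (n : nat) (v : 'cV[R]_n) : R :=
  Num.sqrt (\sum_(i < n) v i ord0 ^+ 2).

(* [H] stands for the factor [H_t^{1/2}]. *)
Definition newton_direction (R : realType) (n d : nat)
    (H : 'M[R]_(n, d)) (g : 'cV[R]_d) : 'cV[R]_d :=
  invmx (H^T *m H) *m g.

(* [invmx A] is [A] when [A] is singular; for a Gaussian sketch, [H] of full
   column rank and [m >= d], this happens with probability zero only. *)
Definition sketched_direction (R : realType) (m n d : nat)
    (H : 'M[R]_(n, d)) (g : 'cV[R]_d) (alpha : R) (S : 'M[R]_(m, n))
    : 'cV[R]_d :=
  alpha *: (invmx (H^T *m S^T *m S *m H) *m g).

Definition theta1 (R : realType) (m d : nat) : R :=
  m%:R / (m%:R - d%:R - 1).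

Definition theta2 (R : realType) (m d : nat) : R :=
  m%:R ^+ 2 * (m%:R - 1) /
  ((m%:R - d%:R) * (m%:R - d%:R - 1) * (m%:R - d%:R - 3)).

Section Estimation.
Context (disp : measure_display) (Omega : measurableType disp) (R : realType).
Variables (P : probability Omega R) (m n d : nat).
Variables (H : 'M[R]_(n, d)) (g : 'cV[R]_d).
Variable S : 'I_m -> 'I_n -> {RV P >-> R}.

Definition direction_error (alpha : R) (w : Omega) : 'cV[R]_n :=
  H *m (sketched_direction H g alpha (sketch_mx S w) - newton_direction H g).

Definition direction_variance (alpha : R) : \bar R :=
  ('E_P[(fun w => l2norm (direction_error alpha w) ^+ 2)%R])%E.

Definition direction_bias (alpha : R) : 'cV[\bar R]_n :=
  expectation_cV P (direction_error alpha).

End Estimation.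

(* Main.v *)
Require Import Defs.
From HB Require Import structures.
From mathcomp Require Import all_boot all_order all_algebra.
From mathcomp Require Import all_classical all_reals all_analysis.
From mathcomp Require Import perm measurable_realfun ring lra.

Import Order.TTheory GRing.Theory Num.Theory.
Import numFieldNormedType.Exports.

Local Open Scope ring_scope.

Set Implicit Arguments.
Unset Strict Implicit.
Unset Printing Implicit Defensive.

(** Write [Pi] for the orthogonal projector onto the columns of [H],
    [N_e = H (H^T (S^T S + e) H)^-1 H^T], and [u = H K^-1 g] with [K = H^T H], so
    that [Pi u = u]. Where [H^T S^T S H] is invertible, the error is
    [alpha N_0 u - u]. The theorem therefore reduces to two moments of an inverse
    Wishart matrix, namely [E N_0 = theta1 Pi] ([first_moment]) and
    [E N_0^2 = theta2 Pi] ([second_moment]): the first one kills the bias for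
    [alpha = 1 / theta1], and both turn the variance into
    [(alpha^2 theta2 - 2 alpha theta1 + 1) |u|^2], whose minimum is at
    [alpha = theta1 / theta2].

    The moments come from Gaussian integration by parts rather than from the
    Wishart density: for smooth [F], bounded as well as its derivative
    [d F / d S_il], the expectation of [S_il F(S)] is [1/m] times that of
    [d F / d S_il] ([sketch_stein]). Take
    [F = (S N_e)_ip (a + b (N_e)_qr)], with [e > 0], and sum over [i]
    ([stein_tensor]). With [N = N_e], [t = tr N] and [c = m - d], contracting
    indices and projecting by [Pi] gives, up to terms that carry a factor [e],
      [m Pi = (c - 1) E N],
      [m E N = (c - 2) E N^2 - E (t N)],
      [m E t Pi = (c - 1) E (t N) - 2 E N^2]
    ([centered_first], [centered_second_a], [centered_second_b]). At [e = 0] this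
    linear system determines [E N] and [E N^2].

    The same identities justify the passage to the limit. In their traces the
    terms with a factor [e] have a favourable sign, so that they bound [E t] if
    [c > 1] and [E t^2] if [c > 3], uniformly in [e] ([integral_trace_le],
    [integral_sqr_trace_le]). Since [N_e] has the eigenvalue [1/e] when
    [H^T S^T S H] is singular, the first bound shows that singularity has
    probability zero ([ae_nonsingular]). Fatou's lemma then makes [tr N_0] and
    its square integrable, and as [tr N_e <= tr N_0] they dominate every term of
    the identities as [e] tends to zero ([dominated_centered]). *)

(** * Positive semidefinite matrices *)

Section PositiveSemidefinite.
Variable R : realFieldType.

Definition psdmx n (M : 'M[R]_n) := forall x : 'cV_n, 0 <= (x^T *m M *m x) 0 0.

Lemma mxtrace_gram_ge0 n p (B : 'M[R]_(n, p)) : 0 <= \tr (B^T *m B).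
Proof.
apply: sumr_ge0 => i _; rewrite mxE; apply: sumr_ge0 => j _.
by rewrite mxE -expr2 sqr_ge0.
Qed.

Lemma mxtrace_psd_ge0 n p (M : 'M[R]_n) (B : 'M[R]_(n, p)) :
  psdmx M -> 0 <= \tr (B^T *m M *m B).
Proof.
move=> Mpsd; apply: sumr_ge0 => i _.
have := Mpsd (col i B); rewrite tr_col -row_mul [in X in X -> _]mxE [in X in _ -> X]mxE.
by under eq_bigr do rewrite [row _ _ _ _]mxE [col _ _ _ _]mxE.
Qed.

Lemma psd_diag_ge0 n (M : 'M[R]_n) i : psdmx M -> 0 <= M i i.
Proof.
move=> /(_ (delta_mx i 0)).
by rewrite trmx_delta -rowE -colE !mxE.
Qed.

Lemma psd_diag_le_tr n (M : 'M[R]_n) i : psdmx M -> M i i <= \tr M.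
Proof.
move=> Mpsd; rewrite /mxtrace (bigD1 i)//= lerDl.
by apply: sumr_ge0 => j _; exact: psd_diag_ge0.
Qed.

(** Test the quadratic form on [e_i + e_j] and on [e_i - e_j]. *)
Lemma psd_entry_le_tr n (M : 'M[R]_n) i j :
  M^T = M -> psdmx M -> `|M i j| <= \tr M.
Proof.
move=> Msym Mpsd.
have sym : M j i = M i j by rewrite -{1}Msym mxE.
have quad (a : R) : 0 <= M i i + a * M i j + a * M j i + a ^+ 2 * M j j.
  have := Mpsd (delta_mx i 0 + a *: delta_mx j 0).
  rewrite [(_ + _)^T]linearD/= [(_ *: _)^T]linearZ/= !trmx_delta mulmxDl -scalemxAl -!rowE.
  rewrite mulmxDr -!scalemxAr -!colE !mxE; lra.
have := quad 1; have := quad (-1); rewrite sym sqrrN expr1n.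
have := psd_diag_le_tr i Mpsd; have := psd_diag_le_tr j Mpsd.
by move=> *; rewrite ler_norml; apply/andP; split; lra.
Qed.

Lemma gram_eq0 n p (B : 'M[R]_(n, p)) : \tr (B^T *m B) = 0 -> B = 0.
Proof.
have ge0 i : 0 <= (B^T *m B) i i.
  by rewrite mxE; apply: sumr_ge0 => j _; rewrite mxE -expr2 sqr_ge0.
move=> /eqP; rewrite psumr_eq0 // => /allP z; apply/matrixP => i j.
have := z j (mem_index_enum _); rewrite mxE /= psumr_eq0; last first.
  by move=> k _; rewrite mxE -expr2 sqr_ge0.
move=> /allP/(_ i (mem_index_enum _))/=.
by rewrite !mxE mulf_eq0 orbb => /eqP.
Qed.

End PositiveSemidefinite.

(** * Weighted hat matrices *)

Section AdjugateInverse.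
Variable R : fieldType.

(** One formula in the entries, singular matrices included, from which
    measurability and differentiability can be read off. *)
Definition adjinv n (A : 'M[R]_n) : 'M[R]_n := (\det A)^-1 *: \adj A.

Lemma adjinvE n (A : 'M[R]_n) : \det A != 0 -> adjinv A = invmx A.
Proof. by move=> A0; rewrite /invmx unitmxE unitfE A0. Qed.

Lemma mulVadj n (A : 'M[R]_n) : \det A != 0 -> adjinv A *m A = 1%:M.
Proof. by move=> A0; rewrite adjinvE// mulVmx// unitmxE unitfE. Qed.

Lemma muladjV n (A : 'M[R]_n) : \det A != 0 -> A *m adjinv A = 1%:M.
Proof. by move=> A0; rewrite adjinvE// mulmxV// unitmxE unitfE. Qed.

(** The oblique projector onto the columns of [H] along the [M]-orthogonal is
    [hatmx H M *m M]; for [M = 1] this is the hat matrix of least squares. The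
    definition is locked so that unification does not unfold it when it matches
    matrix products. *)
Definition hatmx_def n d (H : 'M[R]_(n, d)) (M : 'M[R]_n) : 'M[R]_n :=
  H *m adjinv (H^T *m M *m H) *m H^T.
Fact hatmx_key : unit. Proof. by []. Qed.
Definition hatmx := locked_with hatmx_key hatmx_def.

Lemma hatmxE n d (H : 'M[R]_(n, d)) (M : 'M[R]_n) :
  hatmx H M = H *m adjinv (H^T *m M *m H) *m H^T.
Proof. by rewrite /hatmx unlock. Qed.

Section HatMatrix.
Variables (n d : nat) (H : 'M[R]_(n, d)) (M : 'M[R]_n).
Hypothesis detM : \det (H^T *m M *m H) != 0.

Lemma hatmx_mul_im : hatmx H M *m M *m H = H.
Proof. by rewrite hatmxE -!mulmxA (mulmxA H^T) mulVadj// mulmx1. Qed.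

Lemma im_mul_hatmx : H^T *m M *m hatmx H M = H^T.
Proof. by rewrite hatmxE !mulmxA muladjV// mul1mx. Qed.

(** The image of any hat matrix of [H] lies in that of [H], which the oblique
    projector [hatmx H M *m M] fixes. The identities for regularized hat matrices
    below are instances of this lemma and of its transpose. *)
Lemma hatmx_mul_hatmx M' : hatmx H M *m M *m hatmx H M' = hatmx H M'.
Proof. by rewrite [hatmx H M']hatmxE !mulmxA hatmx_mul_im. Qed.

Lemma hatmx_mul_hatmxr M' : hatmx H M' *m M *m hatmx H M = hatmx H M'.
Proof. by rewrite [hatmx H M']hatmxE -!mulmxA (mulmxA H^T M) im_mul_hatmx !mulmxA. Qed.

Lemma mxtrace_hatmx_mul : \tr (hatmx H M *m M) = d%:R.
Proof.
by rewrite hatmxE -!mulmxA mxtrace_mulC -!mulmxA (mulmxA H^T) mulVadj// mxtrace1.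
Qed.

Lemma trmx_hatmx : M^T = M -> (hatmx H M)^T = hatmx H M.
Proof.
move=> Msym; rewrite hatmxE !trmx_mul trmxK mulmxA; congr (_ *m _ *m _).
have Asym : (H^T *m M *m H)^T = H^T *m M *m H.
  by rewrite !trmx_mul trmxK Msym mulmxA.
by rewrite adjinvE// trmx_inv Asym.
Qed.

End HatMatrix.

End AdjugateInverse.

Section FullColumnRank.
Variables (R : realFieldType) (n d : nat) (H : 'M[R]_(n, d)).
Hypothesis full_rank : \rank H = d.

Lemma full_rank_inj p (v : 'M[R]_(d, p)) : H *m v = 0 -> v = 0.
Proof.
move=> Hv; apply: trmx_inj; rewrite trmx0.
have /row_free_inj : row_free H^T by rewrite /row_free mxrank_tr full_rank.
by apply; rewrite mul0mx -trmx_mul Hv trmx0.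
Qed.

Lemma full_rank_det (M : 'M[R]_n) :
  (forall x : 'cV_n, \tr (x^T *m M *m x) = 0 -> x = 0) ->
  \det (H^T *m M *m H) != 0.
Proof.
move=> Mdef; rewrite -unitfE -unitmxE -row_free_unit.
apply: inj_row_free => v Av; apply: trmx_inj; rewrite trmx0.
apply/full_rank_inj/Mdef.
by rewrite trmx_mul trmxK !mulmxA -(mulmxA v) -(mulmxA v) Av mul0mx linear0.
Qed.

Local Notation Pi := (hatmx H 1%:M).

Lemma hat1_det : \det (H^T *m 1%:M *m H) != 0.
Proof. by apply: full_rank_det => x; rewrite mulmx1; exact: gram_eq0. Qed.

Lemma hat1_mul_im : Pi *m H = H.
Proof. by have := hatmx_mul_im hat1_det; rewrite mulmx1. Qed.

Lemma hat1_mul_hatmx M : Pi *m hatmx H M = hatmx H M.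
Proof. by have := hatmx_mul_hatmx hat1_det M; rewrite mulmx1. Qed.

Lemma mxtrace_hat1 : \tr Pi = d%:R.
Proof. by have := mxtrace_hatmx_mul hat1_det; rewrite mulmx1. Qed.

End FullColumnRank.

(** * The regularized hat matrix of a sketch *)

Section SketchedHat.
Variables (R : realFieldType) (m n d : nat) (H : 'M[R]_(n, d)).
Hypothesis full_rank : \rank H = d.
Implicit Types (S : 'M[R]_(m, n)) (e : R).

(** If [H] has full column rank, then for [e > 0] the inverse exists for every
    sketch, and is bounded. *)
Definition sketched_hat e S := hatmx H (S^T *m S + e%:M).

Lemma regularized_det e S : 0 < e -> \det (H^T *m (S^T *m S + e%:M) *m H) != 0.
Proof.
move=> e0; apply: full_rank_det => // x.
have -> : \tr (x^T *m (S^T *m S + e%:M) *m x) =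
    \tr ((S *m x)^T *m (S *m x)) + e * \tr (x^T *m x).
  rewrite mulmxDr mulmxDl mul_mx_scalar -scalemxAl linearD linearZ/=.
  by rewrite trmx_mul !mulmxA.
move=> tr0; apply: gram_eq0.
by have := mxtrace_gram_ge0 (S *m x); have := mxtrace_gram_ge0 x; nra.
Qed.

Local Notation Pi := (hatmx H 1%:M).

Section Regularized.
Variables (e : R) (S : 'M[R]_(m, n)).
Hypothesis det_eS : \det (H^T *m (S^T *m S + e%:M) *m H) != 0.
Hypothesis e_ge0 : 0 <= e.

Local Notation Q := (S^T *m S).
Local Notation N := (sketched_hat e S).

Let M_sym : (Q + e%:M)^T = Q + e%:M.
Proof. by rewrite linearD/= tr_scalar_mx trmx_mul trmxK. Qed.

Lemma trmx_sketched_hat : N^T = N.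
Proof. exact: trmx_hatmx. Qed.

Lemma sketched_hatC i j : N i j = N j i.
Proof. by rewrite -{1}trmx_sketched_hat mxE. Qed.

Lemma hat1_mul_gram_sketched_hat : Pi *m Q *m N = Pi - e *: N.
Proof.
have := hatmx_mul_hatmxr det_eS 1%:M.
rewrite mulmxDr mulmxDl mul_mx_scalar -scalemxAl (hat1_mul_hatmx full_rank).
by move/(canRL (addrK _)).
Qed.

(** [N M N = N] for the weight [M = Q + e]. *)
Lemma sketched_hat_gram : (S *m N)^T *m (S *m N) = N - e *: (N *m N).
Proof.
have := hatmx_mul_hatmxr det_eS (Q + e%:M).
rewrite mulmxDr mulmxDl mul_mx_scalar -scalemxAl => /(canRL (addrK _)).
by rewrite trmx_mul trmx_sketched_hat !mulmxA.
Qed.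

(** The projector [N M] has trace [d], and [M = Q + e]. *)
Lemma mxtrace_sketch_conj : \tr (S *m N *m S^T) = d%:R - e * \tr N.
Proof.
have := mxtrace_hatmx_mul det_eS.
rewrite mulmxDr mul_mx_scalar linearD linearZ/= => /(canRL (addrK _)) <-.
by rewrite [LHS]mxtrace_mulC mulmxA [RHS]mxtrace_mulC.
Qed.

Lemma psd_sketched_hat : psdmx N.
Proof.
move=> x.
have NE : N *m (Q + e%:M) *m N = N := hatmx_mul_hatmx det_eS _.
have -> : x^T *m N *m x =
    (S *m N *m x)^T *m (S *m N *m x) + e *: ((N *m x)^T *m (N *m x)).
  rewrite -{1}NE mulmxDr mulmxDl mulmxDr mulmxDl mul_mx_scalar -scalemxAl -scalemxAr.
  rewrite -scalemxAl [(N *m x)^T]trmx_mul [(S *m N *m x)^T]trmx_mul.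
  by rewrite [(S *m N)^T]trmx_mul trmx_sketched_hat !mulmxA.
have gram p (y : 'cV[R]_p) : 0 <= (y^T *m y) 0 0.
  by rewrite mxE; apply: sumr_ge0 => i _; rewrite mxE -expr2 sqr_ge0.
by rewrite mxE addr_ge0// mxE mulr_ge0.
Qed.

Lemma sketched_hat_entry i j : `|N i j| <= \tr N.
Proof. exact: psd_entry_le_tr trmx_sketched_hat psd_sketched_hat. Qed.

Lemma tr_sketched_hat_ge0 : 0 <= \tr N.
Proof. by apply: sumr_ge0 => i _; apply: psd_diag_ge0; exact: psd_sketched_hat. Qed.

Lemma tr_sketched_hat2_ge0 : 0 <= \tr (N *m N).
Proof. by rewrite -{1}trmx_sketched_hat mxtrace_gram_ge0. Qed.

Lemma tr_sketched_hat3_ge0 : 0 <= \tr (N *m N *m N).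
Proof.
by rewrite -{1}trmx_sketched_hat; apply: mxtrace_psd_ge0; exact: psd_sketched_hat.
Qed.

Lemma tr_sketched_hat_le : e * \tr N <= d%:R.
Proof.
rewrite -subr_ge0 -mxtrace_sketch_conj -{1}[S]trmxK.
by apply: mxtrace_psd_ge0; exact: psd_sketched_hat.
Qed.

Lemma sketch_conj_diag i : 0 <= (S *m N *m S^T) i i <= d%:R.
Proof.
have psdSNS : psdmx (S *m N *m S^T).
  move=> x; have := psd_sketched_hat (S^T *m x).
  by rewrite trmx_mul trmxK !mulmxA.
rewrite psd_diag_ge0//=; apply: le_trans (psd_diag_le_tr i psdSNS) _.
rewrite mxtrace_sketch_conj lerBlDr lerDl mulr_ge0//; exact: tr_sketched_hat_ge0.
Qed.

(** The squares of a column of [S N] add up to a diagonal entry of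
    [N - e N^2]. *)
Lemma sketch_hat_sqr_le i k : (S *m N) i k ^+ 2 <= \tr N.
Proof.
apply: (@le_trans _ _ (N k k)); last exact/psd_diag_le_tr/psd_sketched_hat.
have /matrixP/(_ k k) := sketched_hat_gram.
rewrite [X in _ = X]mxE [X in _ = _ + X]mxE [X in _ = _ - X]mxE => kk.
have ge0 : 0 <= e * (N *m N) k k.
  rewrite mulr_ge0// -{1}trmx_sketched_hat mxE; apply: sumr_ge0 => j _.
  by rewrite mxE -expr2 sqr_ge0.
have : (S *m N) i k ^+ 2 <= ((S *m N)^T *m (S *m N)) k k.
  rewrite [leRHS]mxE (bigD1 i)//= [_^T _ _]mxE -expr2 lerDl.
  by apply: sumr_ge0 => j _; rewrite [_^T _ _]mxE -expr2 sqr_ge0.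
by rewrite kk; lra.
Qed.

End Regularized.

(** The resolvent identity [N_0 - N_e = e N_0 N_e], applied twice. *)
Lemma tr_sketched_hat_mono e S : 0 < e ->
  \det (H^T *m (S^T *m S) *m H) != 0 ->
  \tr (sketched_hat e S) <= \tr (sketched_hat 0 S).
Proof.
move=> e0 det0; have det_e := regularized_det S e0.
have det0' : \det (H^T *m (S^T *m S + 0%:M) *m H) != 0 by rewrite [0%:M]raddf0 addr0.
set N0 := sketched_hat 0 S; set N := sketched_hat e S.
have N0E : N0 = N + e *: (N0 *m N).
  rewrite -[LHS](hatmx_mul_hatmxr det_e (S^T *m S + 0%:M)).
  rewrite mulmxDr mulmxDl mul_mx_scalar -scalemxAl; congr (_ + _).
  rewrite -[RHS](hatmx_mul_hatmx det0' (S^T *m S + e%:M)).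
  by rewrite /N0 /sketched_hat [0%:M]raddf0 addr0.
have : 0 <= \tr (N *m N0 *m N).
  have NT : N^T = N := trmx_sketched_hat det_e.
  by rewrite -{1}NT; apply: mxtrace_psd_ge0; exact: psd_sketched_hat.
have := tr_sketched_hat2_ge0 det_e.
have trE : \tr N0 = \tr N + e * (\tr (N *m N) + e * \tr (N *m N0 *m N)).
  rewrite {1}N0E linearD linearZ/=; congr (_ + e * _).
  rewrite {1}N0E mulmxDl linearD/= -scalemxAl linearZ/=; congr (_ + e * _).
  by rewrite mxtrace_mulC mulmxA.
move=> tr2 trN0N; rewrite trE lerDl; apply: mulr_ge0; first exact: ltW.
by apply: addr_ge0 => //; apply: mulr_ge0 => //; exact: ltW.
Qed.

(** If [H^T S^T S H] kills [v], then [H v] is an eigenvector of the regularized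
    hat matrix for the eigenvalue [1/e]. *)
Lemma tr_sketched_hat_singular e S : 0 < e ->
  \det (H^T *m (S^T *m S) *m H) = 0 -> 1 <= e * (n%:R * \tr (sketched_hat e S)).
Proof.
move=> e0 det0; have det_e := regularized_det S e0; set N := sketched_hat e S.
have trN0 : 0 <= \tr N := tr_sketched_hat_ge0 det_e (ltW e0).
have [v v0 Av] : exists2 v : 'rV_d, v != 0 & v *m (H^T *m (S^T *m S) *m H) = 0.
  by apply/det0P; rewrite det0.
pose x := H *m v^T.
have Nx : e *: (N *m x) = x.
  have /(congr1 (mulmx^~ v^T)) := hatmx_mul_im det_e.
  rewrite mulmxDr mulmxDl mul_mx_scalar -scalemxAl mulmxDl -scalemxAl -!mulmxA.
  have -> : N *m (S^T *m (S *m (H *m v^T))) = 0.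
    rewrite /N /sketched_hat hatmxE -!mulmxA.
    have -> : H^T *m (S^T *m (S *m (H *m v^T))) = 0; last by rewrite !mulmx0.
    move/(congr1 trmx): Av; rewrite !trmx_mul !trmxK trmx0 => <-.
    by rewrite !mulmxA.
  by rewrite add0r.
have /matrix0Pn [i0 [j0 xij]] : x != 0.
  apply: contraNneq v0 => /(full_rank_inj full_rank) /(congr1 trmx).
  by rewrite trmxK trmx0 => ->.
have {}xij : x i0 0 != 0 by rewrite -(ord1 j0).
have [i _ imax] := arg_maxP (fun k => `|x k 0|) (erefl (xpredT i0)).
have xi : 0 < `|x i 0|.
  by apply: lt_le_trans (imax i0 _) => //; rewrite normr_gt0.
rewrite -(ler_pM2r xi) mul1r.
rewrite -{1}Nx mxE normrM gtr0_norm// -!mulrA ler_wpM2l ?(ltW e0)//.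
rewrite mxE; apply: le_trans (ler_norm_sum _ _ _) _.
apply: (@le_trans _ _ (\sum_(j < n) \tr N * `|x i 0|)).
  apply: ler_sum => j _; rewrite normrM ler_pM//; last exact: imax.
  exact: sketched_hat_entry det_e (ltW e0) _ _.
by rewrite sumr_const card_ord mulr_natl.
Qed.

End SketchedHat.

(** * Measurability and derivatives of matrix-valued functions *)

Section MeasurableMatrices.
Context {disp : measure_display} {T : measurableType disp} {R : realType}.

Definition measurable_mx p q (A : T -> 'M[R]_(p, q)) :=
  forall i j, measurable_fun setT (fun x => A x i j).

(** [x^-1] is [x] times the real power [-1] of [x^2], also at [x = 0]. *)
Lemma measurable_funV (f : T -> R) :
  measurable_fun setT f -> measurable_fun setT (fun x => (f x)^-1).
Proof.
move=> mf.
rewrite (_ : (fun x => _) = fun x => f x * (f x ^+ 2) `^ (-1)); last first.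
  apply/funext => x; rewrite powR_inv1 ?sqr_ge0//.
  have [->|fx0] := eqVneq (f x) 0; first by rewrite invr0 mul0r.
  by rewrite expr2 invfM mulrA divff// mul1r.
apply: measurable_funM => //.
apply: (@measurableT_comp _ _ _ _ _ _ (@powR R ^~ (-1)) _ (fun x => f x ^+ 2)).
  exact: measurable_powR.
exact: measurable_funX.
Qed.

Lemma measurable_mx_cst p q (A : 'M[R]_(p, q)) : measurable_mx (fun=> A).
Proof. by move=> i j; exact: measurable_cst. Qed.

Lemma measurable_mxD p q (A B : T -> 'M[R]_(p, q)) :
  measurable_mx A -> measurable_mx B -> measurable_mx (fun x => A x + B x).
Proof.
move=> mA mB i j; under eq_fun do rewrite mxE.
exact: measurable_funD.
Qed.

Lemma measurable_mxZ p q (f : T -> R) (A : T -> 'M[R]_(p, q)) :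
  measurable_fun setT f -> measurable_mx A ->
  measurable_mx (fun x => f x *: A x).
Proof.
move=> mf mA i j; under eq_fun do rewrite mxE.
exact: measurable_funM.
Qed.

Lemma measurable_mxM p q r (A : T -> 'M[R]_(p, q)) (B : T -> 'M[R]_(q, r)) :
  measurable_mx A -> measurable_mx B -> measurable_mx (fun x => A x *m B x).
Proof.
move=> mA mB i j; under eq_fun do rewrite mxE.
by apply: measurable_sum => k; exact: measurable_funM.
Qed.

Lemma measurable_mx_tr p q (A : T -> 'M[R]_(p, q)) :
  measurable_mx A -> measurable_mx (fun x => (A x)^T).
Proof. by move=> mA i j; under eq_fun do rewrite mxE; exact: mA. Qed.

Lemma measurable_mxtrace p (A : T -> 'M[R]_p) :
  measurable_mx A -> measurable_fun setT (fun x => \tr (A x)).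
Proof. by move=> mA; apply: measurable_sum => i; exact: mA. Qed.

Lemma measurable_det p (A : T -> 'M[R]_p) :
  measurable_mx A -> measurable_fun setT (fun x => \det (A x)).
Proof.
move=> mA; rewrite /determinant; apply: measurable_sum => s.
by apply: measurable_funM => //; apply: measurable_prod => i _; exact: mA.
Qed.

Lemma measurable_adjinv p (A : T -> 'M[R]_p) :
  measurable_mx A -> measurable_mx (fun x => adjinv (A x)).
Proof.
move=> mA; apply: measurable_mxZ; first exact/measurable_funV/measurable_det.
move=> i j; under eq_fun do rewrite mxE.
apply: measurable_funM => //; apply: measurable_det => k l.
by under eq_fun do rewrite !mxE; exact: mA.
Qed.

Lemma measurable_invmx p (A : T -> 'M[R]_p) :
  measurable_mx A -> measurable_mx (fun x => invmx (A x)).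
Proof.
move=> mA i j.
rewrite (_ : (fun x => _) =
  fun x => if \det (A x) == 0 then A x i j else adjinv (A x) i j).
  apply: measurable_fun_ifT; [|exact: mA|exact: measurable_adjinv].
  by apply: measurable_fun_eqr => //; exact: measurable_det.
apply/funext => x; have [A0|A0] := eqVneq (\det (A x)) 0; last first.
  by rewrite adjinvE.
by rewrite /invmx unitmxE unitfE A0 eqxx.
Qed.

End MeasurableMatrices.

Section DerivableMatrices.
Context {R : realType}.
Implicit Types (t : R).

Definition is_derive_mx p q t (A : R -> 'M[R]_(p, q)) (dA : 'M[R]_(p, q)) :=
  forall i j, is_derive t 1 (fun s => A s i j) (dA i j).

Definition derivable_mx p q t (A : R -> 'M[R]_(p, q)) :=
  forall i j, derivable (fun s => A s i j) t 1.

Lemma is_derive_mx_unique p q t (A : R -> 'M[R]_(p, q)) dA dA' :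
  is_derive_mx t A dA -> is_derive_mx t A dA' -> dA = dA'.
Proof.
move=> d1 d2; apply/matrixP => i j.
by have [_ <-] := d1 i j; have [_ <-] := d2 i j.
Qed.

Lemma is_derive_mx_derivable p q t (A : R -> 'M[R]_(p, q)) dA :
  is_derive_mx t A dA -> derivable_mx t A.
Proof. by move=> dAt i j; have [] := dAt i j. Qed.

Lemma derivable_is_derive_mx p q t (A : R -> 'M[R]_(p, q)) :
  derivable_mx t A -> exists dA, is_derive_mx t A dA.
Proof.
move=> dAt; exists (\matrix_(i, j) 'D_1 (fun s => A s i j) t) => i j.
by rewrite mxE; exact/derivableP.
Qed.

Lemma is_derive_mx_cst p q t (A : 'M[R]_(p, q)) : is_derive_mx t (fun=> A) 0.
Proof. by move=> i j; rewrite mxE; exact: is_derive_cst. Qed.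

Lemma is_derive_mx_line p q t (A B : 'M[R]_(p, q)) :
  is_derive_mx t (fun s => A + s *: B) B.
Proof.
move=> i j; under eq_fun do rewrite !mxE.
apply: (is_derive_eq (is_deriveD (is_derive_cst (A i j) t 1)
  (is_deriveM (is_derive_id t 1) (is_derive_cst (B i j) t 1)))).
by rewrite scaler0 !add0r; exact: mulr1.
Qed.

Lemma is_derive_mxD p q t (A B : R -> 'M[R]_(p, q)) dA dB :
  is_derive_mx t A dA -> is_derive_mx t B dB ->
  is_derive_mx t (fun s => A s + B s) (dA + dB).
Proof.
move=> dAt dBt i j; rewrite mxE; under eq_fun do rewrite mxE.
exact: is_deriveD.
Qed.

Lemma is_derive_mxM p q r t (A : R -> 'M[R]_(p, q)) (B : R -> 'M[R]_(q, r)) dA dB :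
  is_derive_mx t A dA -> is_derive_mx t B dB ->
  is_derive_mx t (fun s => A s *m B s) (dA *m B t + A t *m dB).
Proof.
move=> dAt dBt i j; rewrite !mxE -big_split/=.
rewrite (_ : (fun s => _) = \sum_k (fun s => A s i k * B s k j)); last first.
  by apply/funext => s; rewrite fct_sumE mxE.
apply: (@is_derive_sum R R R q (fun k s => A s i k * B s k j) t 1
  (fun k => dA i k * B t k j + A t i k * dB k j)) => k.
apply: (is_derive_eq (is_deriveM (dAt i k) (dBt k j))).
by rewrite addrC mulrC.
Qed.

Lemma is_derive_mx_tr p q t (A : R -> 'M[R]_(p, q)) dA :
  is_derive_mx t A dA -> is_derive_mx t (fun s => (A s)^T) dA^T.
Proof.
by move=> dAt i j; rewrite mxE; under eq_fun do rewrite mxE; exact: dAt.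
Qed.

Lemma derivable_prod_seq I (r : seq I) (f : I -> R -> R) t :
  (forall i, derivable (f i) t 1) ->
  derivable (fun s => \prod_(i <- r) f i s) t 1.
Proof.
move=> df; elim: r => [|i r ih].
  by under eq_fun do rewrite big_nil; exact: derivable_cst.
by under eq_fun do rewrite big_cons; exact: derivableM.
Qed.

Lemma derivable_sum_seq I (r : seq I) (f : I -> R -> R) t :
  (forall i, derivable (f i) t 1) ->
  derivable (fun s => \sum_(i <- r) f i s) t 1.
Proof.
move=> df; elim: r => [|i r ih].
  by under eq_fun do rewrite big_nil; exact: derivable_cst.
by under eq_fun do rewrite big_cons; exact: derivableD.
Qed.

Lemma derivable_det p (A : R -> 'M[R]_p) t :
  derivable_mx t A -> derivable (fun s => \det (A s)) t 1.
Proof.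
move=> dA; apply: derivable_sum_seq => s.
apply: derivableM; first exact: derivable_cst.
by apply: derivable_prod_seq => i; exact: dA.
Qed.

(** The determinant and the cofactors are polynomials in the entries. *)
Lemma derivable_adjinv p (A : R -> 'M[R]_p) t :
  derivable_mx t A -> \det (A t) != 0 -> derivable_mx t (fun s => adjinv (A s)).
Proof.
move=> dA A0 i j; under eq_fun do rewrite !mxE.
apply: derivableM; first by apply: derivableV => //; exact: derivable_det.
apply: derivableM; first exact: derivable_cst.
apply: derivable_det => k l; under eq_fun do rewrite !mxE.
exact: dA.
Qed.

(** Differentiate [adjinv (A s) *m A s = 1]. *)
Lemma is_derive_adjinv p (A : R -> 'M[R]_p) dA t :
  is_derive_mx t A dA -> (forall s, \det (A s) != 0) ->
  is_derive_mx t (fun s => adjinv (A s))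
    (- (adjinv (A t) *m dA *m adjinv (A t))).
Proof.
move=> dAt A0.
have [dV dVt] :=
  derivable_is_derive_mx (derivable_adjinv (is_derive_mx_derivable dAt) (A0 t)).
suff <- : dV = - (adjinv (A t) *m dA *m adjinv (A t)) by [].
have VA : is_derive_mx t (fun s => adjinv (A s) *m A s) 0.
  under eq_fun do rewrite mulVadj//; exact: is_derive_mx_cst.
have /(congr1 (mulmx^~ (adjinv (A t)))) :=
  is_derive_mx_unique (is_derive_mxM dVt dAt) VA.
rewrite mulmxDl mul0mx -(mulmxA dV) muladjV// mulmx1.
by move/eqP; rewrite addr_eq0 => /eqP.
Qed.

Lemma is_derive_hatmx n d (H : 'M[R]_(n, d)) (M : R -> 'M[R]_n) dM t :
  is_derive_mx t M dM -> (forall s, \det (H^T *m M s *m H) != 0) ->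
  is_derive_mx t (fun s => hatmx H (M s)) (- (hatmx H (M t) *m dM *m hatmx H (M t))).
Proof.
move=> dMt M0; have cstH q r (B : 'M[R]_(q, r)) := is_derive_mx_cst t B.
have dHMH := is_derive_mxM (is_derive_mxM (cstH _ _ H^T) dMt) (cstH _ _ H).
have /= := is_derive_mxM (is_derive_mxM (cstH _ _ H) (is_derive_adjinv dHMH M0))
  (cstH _ _ H^T).
under eq_fun do rewrite -hatmxE.
by rewrite !mulmx0 !mul0mx !addr0 !add0r hatmxE mulmxN mulNmx !mulmxA.
Qed.

End DerivableMatrices.

(** * Gaussian integration by parts *)

Section GaussianIntegration.
Local Open Scope classical_set_scope.
Context {R : realType}.
Variable sigma : R.
Hypothesis sigma_neq0 : sigma != 0.
Local Notation mu := (@lebesgue_measure R).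
Local Notation gamma := (normal_prob 0 sigma).
Local Notation phi := (normal_pdf 0 sigma).

(** The density is the Radon-Nikodym derivative, almost everywhere. *)
Lemma ge0_integral_normal_prob (f : R -> \bar R) :
  measurable_fun setT f -> (forall x, 0 <= f x)%E ->
  (\int[gamma]_x f x = \int[mu]_x (f x * (phi x)%:E))%E.
Proof.
move=> mf f0; have dom := normal_prob_dominates 0 sigma.
have RN := Radon_Nikodym_SigmaFinite.f_integrable dom.
have mphi : measurable_fun setT (fun x => (phi x)%:E).
  by apply/measurable_EFinP; exact: measurable_normal_pdf.
rewrite -(Radon_Nikodym_SigmaFinite.change_of_variables dom)//.
apply: ae_eq_integral => //.
- by apply: emeasurable_funM => //; exact: measurable_int RN.
- exact: emeasurable_funM.
- apply: ae_eqe_mul2l; apply: integral_ae_eq => // A _ mA.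
  by rewrite -Radon_Nikodym_SigmaFinite.f_integral.
Qed.

Lemma integrable_normal_prob (f : R -> R) : measurable_fun setT f ->
  mu.-integrable setT (fun x => (f x * phi x)%:E) ->
  gamma.-integrable setT (EFin \o f).
Proof.
move=> mf /integrableP[_ fin]; apply/integrableP; split.
  exact/measurable_EFinP.
rewrite ge0_integral_normal_prob//.
  under eq_integral => x _ do
    rewrite -[(phi x)%:E]gee0_abs ?lee_fin ?normal_pdf_ge0// -abseM.
  exact: fin.
by apply: measurableT_comp => //; exact/measurable_EFinP.
Qed.

Lemma integral_normal_prob (f : R -> R) : measurable_fun setT f ->
  mu.-integrable setT (fun x => (f x * phi x)%:E) ->
  (\int[gamma]_x (f x)%:E = \int[mu]_x (f x * phi x)%:E)%E.
Proof.
move=> mf intf.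
rewrite integralE [in RHS]integralE; congr (_ - _)%E.
  rewrite ge0_integral_normal_prob//; last first.
    by apply: measurable_funepos; exact/measurable_EFinP.
  apply: eq_integral => x _; rewrite !funeposE muleC maxe_pMr ?mule0 ?lee_fin ?normal_pdf_ge0//.
  by rewrite EFinM muleC.
rewrite ge0_integral_normal_prob//; last first.
  by apply: measurable_funeneg; exact/measurable_EFinP.
apply: eq_integral => x _; rewrite !funenegE muleC maxe_pMr ?mule0 ?lee_fin ?normal_pdf_ge0//.
by rewrite muleN EFinM muleC.
Qed.

(** With [x = t^2 / (4 sigma^2)], the inequality [x exp(-x) <= 1] bounds
    [t^2 phi] by a multiple of [exp(-x)], the centered Gaussian density with twice
    the variance up to a constant. *)
Lemma integrable_id_normal_pdf :
  mu.-integrable setT (fun t => (t * phi t)%:E).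
Proof.
pose tau := Num.sqrt 2 * sigma.
have tau0 : tau != 0 by rewrite mulf_neq0// sqrtr_eq0 -ltNge.
pose C := 4 * sigma ^+ 2 * normal_peak sigma / normal_peak tau.
apply: (@le_integrable _ (measurableTypeR R) R mu setT measurableT _
  (fun t => (phi t + C * normal_pdf 0 tau t)%:E)).
- apply/measurable_EFinP; apply: measurable_funM => //.
  exact: measurable_normal_pdf.
- move=> t _; rewrite /= lee_fin normrM (ger0_norm (normal_pdf_ge0 _ _ _)).
  rewrite [leRHS]ger0_norm; last first.
    rewrite addr_ge0 ?normal_pdf_ge0// mulr_ge0 ?normal_pdf_ge0//.
    apply: divr_ge0; last exact: normal_peak_ge0.
    by apply: mulr_ge0; [rewrite mulr_ge0// sqr_ge0|exact: normal_peak_ge0].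
  rewrite !normal_pdfE// /normal_fun subr0.
  have s20 : 0 < sigma ^+ 2 by rewrite exprn_even_gt0.
  set x := t ^+ 2 / (4 * sigma ^+ 2).
  have -> : - t ^+ 2 / (tau ^+ 2 *+ 2) = - x.
    rewrite /tau exprMn sqr_sqrtr// /x -mulr_natr.
    by field; rewrite sigma_neq0.
  have -> : - t ^+ 2 / (sigma ^+ 2 *+ 2) = - x + - x.
    by rewrite /x -mulr_natr; field.
  rewrite expRD /C.
  have -> : 4 * sigma ^+ 2 * normal_peak sigma / normal_peak tau *
      (normal_peak tau * expR (- x)) = 4 * sigma ^+ 2 * normal_peak sigma * expR (- x).
    by field; rewrite gt_eqF// normal_peak_gt0.
  have peak0 := normal_peak_ge0 sigma.
  have xe : x * expR (- x) <= 1.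
    rewrite expRN ler_pdivrMr ?expR_gt0// mul1r.
    by apply: le_trans (expR_ge1Dx x); rewrite lerDr.
  have t2 : t ^+ 2 = 4 * sigma ^+ 2 * x by rewrite /x; field.
  have tle : `|t| <= 1 + t ^+ 2.
    rewrite -(real_normK (num_real t)).
    by have := sqr_ge0 (`|t| - 1); have := sqr_ge0 `|t|; lra.
  have e0 := expR_ge0 (- x).
  apply: le_trans (_ : (1 + t ^+ 2) * (normal_peak sigma * (expR (- x) * expR (- x))) <= _).
    by rewrite ler_wpM2r// !mulr_ge0.
  rewrite mulrDl mul1r lerD2l t2.
  have -> : 4 * sigma ^+ 2 * x * (normal_peak sigma * (expR (- x) * expR (- x))) =
      4 * sigma ^+ 2 * normal_peak sigma * expR (- x) * (x * expR (- x)) by ring.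
  apply: ler_piMr => //; apply: mulr_ge0 => //; apply: mulr_ge0 => //.
  by apply: mulr_ge0 => //; exact: ltW.
- apply: (@integrableD _ (measurableTypeR R) R mu setT measurableT
    (fun t => (phi t)%:E) (fun t => C%:E * (normal_pdf 0 tau t)%:E)%E).
    exact: integrable_normal_pdf.
  by apply: integrableZl => //; exact: integrable_normal_pdf.
Qed.

Lemma integrable_id_normal_prob : gamma.-integrable setT (fun t => t%:E).
Proof.
by apply: (integrable_normal_prob (f := id)) => //; exact: integrable_id_normal_pdf.
Qed.

Lemma is_derive_normal_pdf (t : R) :
  is_derive t 1 phi (- (t / sigma ^+ 2) * phi t).
Proof.
rewrite normal_pdfE//=.
have -> : normal_fun 0 sigma = fun x => expR ((- (2 * sigma ^+ 2)^-1) * x ^+ 2).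
  apply/funext => x; rewrite /normal_fun subr0; congr expR.
  by rewrite mulNr mulNr mulrC; congr (- (_^-1 * _)); rewrite mulr_natl.
apply: is_derive_eq.
by rewrite /GRing.scale/=; field.
Qed.

Lemma normal_pdf_sym t : phi (- t) = phi t.
Proof. by rewrite !normal_pdfE// /normal_fun !subr0 sqrrN. Qed.

Lemma normal_pdf_cvg0 : phi k.+1%:R @[k --> \oo] --> 0.
Proof.
pose C := normal_peak sigma * (2 * sigma ^+ 2).
have s20 : 0 < sigma ^+ 2 by rewrite exprn_even_gt0.
have C0 : C * k.+1%:R^-1 @[k --> \oo] --> 0.
  by rewrite -[0](mulr0 C); apply: cvgM; [exact: cvg_cst|exact: cvg_harmonic].
apply: (squeeze_cvgr _ (cvg_cst 0) C0); apply: nearW => k.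
rewrite normal_pdf_ge0/= normal_pdfE// /normal_fun subr0 mulNr expRN /C -mulrA.
have k1 : 1 <= k.+1%:R :> R by rewrite ler1n.
apply: ler_wpM2l; first exact: normal_peak_ge0.
have kx : k.+1%:R / (2 * sigma ^+ 2) <= expR (k.+1%:R ^+ 2 / (sigma ^+ 2 *+ 2)).
  apply: le_trans (expR_ge1Dx _).
  rewrite -[sigma ^+ 2 *+ 2]mulr_natl -[leLHS]add0r lerD// ler_wpM2r//.
    by rewrite invr_ge0 mulr_ge0// ltW.
  by rewrite expr2 ler_peMl.
have -> : 2 * sigma ^+ 2 / k.+1%:R = (k.+1%:R / (2 * sigma ^+ 2))^-1.
  by rewrite invfM invrK mulrC.
by rewrite lef_pV2// posrE ?expR_gt0// divr_gt0// mulr_gt0.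
Qed.

(** Times [phi], the integrand is the derivative of [- sigma^2 f phi], which
    vanishes at infinity. *)
Lemma gaussian_stein (f df : R -> R) (C : R) :
  (forall t : R, is_derive t 1 f (df t)) -> continuous df ->
  (forall t, `|f t| <= C) -> (forall t, `|df t| <= C) ->
  gamma.-integrable setT (fun t => (t * f t - sigma ^+ 2 * df t)%:E) /\
  (\int[gamma]_t (t * f t - sigma ^+ 2 * df t)%:E = 0)%E.
Proof.
move=> dfE cdf fC dfC.
have cf : continuous f.
  by move=> t; apply/differentiable_continuous/derivable1_diffP; have [] := dfE t.
have mf : measurable_fun setT f := continuous_measurable_fun cf.
have mdf : measurable_fun setT df := continuous_measurable_fun cdf.
have mphi := measurable_normal_pdf (0 : R) sigma.
have cphi : continuous phi := continuous_normal_pdf sigma_neq0.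
have C0 : 0 <= C := le_trans (normr_ge0 _) (fC 0).
pose h t := t * f t - sigma ^+ 2 * df t.
have mh : measurable_fun setT h.
  by apply: measurable_funB; apply: measurable_funM.
pose g t := h t * phi t.
have mg : measurable_fun setT g by exact: measurable_funM.
have cg : continuous g.
  move=> t; apply: cvgM; last exact: cphi.
  apply: cvgB; apply: cvgM; [exact: cvg_id|exact: cf|exact: cvg_cst|exact: cdf].
have ig : mu.-integrable setT (EFin \o g).
  apply: (@le_integrable _ (measurableTypeR R) R mu setT measurableT _
    (fun t => C%:E * `|(t * phi t)%:E| + (sigma ^+ 2 * C)%:E * (phi t)%:E)%E).
  - exact/measurable_EFinP.
  - move=> t _; rewrite /= lee_fin /g /h normrM.
    have phi0 : 0 <= phi t by exact: normal_pdf_ge0.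
    rewrite (ger0_norm phi0).
    apply: le_trans (_ : (`|t| * C + sigma ^+ 2 * C) * phi t <= _).
      apply: ler_wpM2r => //; apply: le_trans (ler_normB _ _) _.
      rewrite (normrM t) (normrM (sigma ^+ 2)) (ger0_norm (sqr_ge0 sigma)).
      by rewrite lerD// ler_wpM2l// sqr_ge0.
    rewrite [leRHS]ger0_norm; first by rewrite normrM (ger0_norm phi0); lra.
    apply: addr_ge0; first by rewrite mulr_ge0.
    by rewrite mulr_ge0// mulr_ge0// sqr_ge0.
  - apply: (@integrableD _ (measurableTypeR R) R mu setT measurableT
      (fun t => C%:E * `|(t * phi t)%:E|)%E
      (fun t => (sigma ^+ 2 * C)%:E * (phi t)%:E)%E).
      apply: integrableZl => //; apply: integrable_abse.
      exact: integrable_id_normal_pdf.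
    by apply: integrableZl => //; exact: integrable_normal_pdf.
split; first exact: integrable_normal_prob mh ig.
rewrite integral_normal_prob//.
pose G t := - sigma ^+ 2 * (f t * phi t).
have dG (t : R) : is_derive t 1 G (g t).
  have dphi := is_derive_normal_pdf t; have dft := dfE t.
  apply: is_derive_eq.
  by rewrite /GRing.scale/= /g /h; field.
have cG : continuous G.
  by move=> t; apply/differentiable_continuous/derivable1_diffP; have [] := dG t.
have FTC k : (\int[mu]_(t in `[(- k.+1%:R)%R, k.+1%:R%R]) (g t)%:E =
    (G k.+1%:R - G (- k.+1%:R))%R%:E)%E.
  rewrite (@continuous_FTC2 R g G)//.
  - by apply: (@lt_trans _ _ 0); rewrite ?oppr_lt0 ltr0n.
  - by apply: continuous_subspaceT.
  - split.
    + by move=> t _; have [] := dG t.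
    + by apply: cvg_at_right_filter; exact: cG.
    + by apply: cvg_at_left_filter; exact: cG.
  - by move=> t _; rewrite derive1E; have [_ ->] := dG t.
have lim0 : (\int[mu]_(t in `[(- k.+1%:R)%R, k.+1%:R%R]) (g t)%:E @[k --> \oo] --> 0)%E.
  under eq_fun do rewrite FTC.
  suff G0 : G k.+1%:R - G (- k.+1%:R) @[k --> \oo] --> 0.
    by apply: cvg_EFin; [exact: nearW|exact: G0].
  have B0 : 2 * sigma ^+ 2 * C * phi k.+1%:R @[k --> \oo] --> 0.
    rewrite -[X in _ --> X](mulr0 (2 * sigma ^+ 2 * C)).
    by apply: cvgM; [exact: cvg_cst|exact: normal_pdf_cvg0].
  apply/cvgr0Pnorm_le => e e0; near=> k.
  apply: (@le_trans _ _ (2 * sigma ^+ 2 * C * phi k.+1%:R)).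
    apply: le_trans (ler_normB _ _) _.
    have phi0 : 0 <= phi k.+1%:R by exact: normal_pdf_ge0.
    rewrite /G 2!(normrM (- sigma ^+ 2)) normrN (ger0_norm (sqr_ge0 sigma)).
    rewrite !(normrM (f _)) normal_pdf_sym.
    rewrite (ger0_norm phi0) -mulrDr -mulrDl.
    have fk := fC k.+1%:R; have fNk := fC (- k.+1%:R).
    have -> : 2 * sigma ^+ 2 * C * phi k.+1%:R = sigma ^+ 2 * ((C + C) * phi k.+1%:R).
      by ring.
    by rewrite ler_wpM2l ?sqr_ge0// ler_wpM2r// lerD.
  by near: k; exact: (cvgr_le _ B0).
have lim : (\int[mu]_(t in `[(- k.+1%:R)%R, k.+1%:R%R]) (g t)%:E @[k --> \oo] -->
    \int[mu]_t (g t)%:E)%E.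
  pose F k := (EFin \o g) \_ `[(- k.+1%:R)%R, k.+1%:R%R].
  have [|||||_ _] := @dominated_convergence _ (measurableTypeR R) R mu setT
    measurableT F (EFin \o g) (abse \o (EFin \o g)).
  - move=> k; apply/(measurable_restrictT _ _).1 => //.
    by apply: measurable_funTS; exact/measurable_EFinP.
  - exact/measurable_EFinP.
  - apply: aeW => t _; apply: cvg_near_cst.
    exists (Num.truncn `|t|) => // k /= tk; rewrite /F patchE mem_set//=.
    rewrite in_itv/= -ler_norml ltW//; apply: lt_le_trans (truncnS_gt _) _.
    by rewrite ler_nat.
  - exact: integrable_abse.
  - apply: aeW => t k _; rewrite /F patchE; case: ifPn => // _.
    by rewrite abse0 abse_ge0.
  by under [X in _ -> X @ _ --> _]eq_fun do rewrite integral_mkcond.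
exact: cvg_unique lim lim0.
Unshelve. all: by end_near.
Qed.
End GaussianIntegration.

(** * Independence of one coordinate from the others *)

Section Freezing.
Local Open Scope classical_set_scope.
Context {disp : measure_display} {Omega : measurableType disp} {R : realType}.
Variables (P : probability Omega R) (I : finType) (X : I -> {RV P >-> R}).
Variable i0 : I.
Hypothesis indep : mutually_independent X.

(** Boxes in all coordinates but [i0]; they generate the sigma-algebra of the
    events that do not involve [X i0]. *)
Definition boxes_without : set (set Omega) :=
  [set A | exists2 B : I -> set R, (forall j, measurable (B j)) &
     A = \bigcap_(j in [set` [set~ i0]%SET]) (X j @^-1` B j)].

Local Notation frozen := (g_sigma_algebraType boxes_without).

Lemma boxes_withoutI : setI_closed boxes_without.
Proof.
move=> _ _ [B mB ->] [B' mB' ->]; exists (fun j => B j `&` B' j).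
  by move=> j; exact: measurableI.
by rewrite -bigcapI; apply: eq_bigcapr => j _; rewrite preimage_setI.
Qed.

Lemma boxes_withoutT : boxes_without setT.
Proof.
exists (fun=> setT); first by move=> _; exact: measurableT.
by rewrite bigcapT // => j _; rewrite preimage_setT.
Qed.

Lemma measurable_boxes_without A : boxes_without A -> measurable A.
Proof.
move=> [B mB ->]; apply: fin_bigcap_measurable => // j _.
by rewrite -[X in measurable X]setTI; exact: measurable_funPT.
Qed.

Lemma independent_box (A : set R) (E : set Omega) : measurable A ->
  boxes_without E -> (P (E `&` X i0 @^-1` A) = P (X i0 @^-1` A) * P E)%E.
Proof.
move=> mA [B mB ->].
pose B' j := if j == i0 then A else B j.
have mB' j : measurable (B' j) by rewrite /B'; case: eqP.
have B'E j : j \in [set~ i0]%SET -> B' j = B j.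
  by rewrite !inE /B' => /negbTE ->.
have -> : \bigcap_(j in [set` [set~ i0]%SET]) (X j @^-1` B j) `&` X i0 @^-1` A =
    \bigcap_(j in [set` [set: I]%SET]) (X j @^-1` B' j).
  apply/seteqP; split=> [w [/= Bw Aw] j _|w /= B'w].
    rewrite /B'; case: eqP => [->//|/eqP jn]; apply: Bw => /=.
    by rewrite !inE.
  split; last by have := B'w i0; rewrite /B' eqxx; apply; rewrite /= inE.
  by move=> j /= jn; have := B'w j; rewrite B'E//; apply; rewrite /= inE.
rewrite (indep (J := [set: I]%SET)) => [|j _]//.
rewrite (bigD1 i0) ?inE//=; congr (_ * _)%E; first by rewrite /B' eqxx.
rewrite (indep (J := [set~ i0]%SET)) => [|j _]//.
by apply: eq_big => j; rewrite !inE// => jn; rewrite B'E// !inE.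
Qed.

(** Independence extends from boxes to the sigma-algebra that they generate,
    because boxes are stable under intersection. *)
Lemma independent_frozen (A : set R) (E : set frozen) : measurable A ->
  measurable E -> (P (E `&` X i0 @^-1` A) = P (X i0 @^-1` A) * P E)%E.
Proof.
move=> mA mE.
have mXA : measurable (X i0 @^-1` A).
  by rewrite -[X in measurable X]setTI; exact: measurable_funPT.
have fA0 : 0 <= fine (P (X i0 @^-1` A)) by rewrite fine_ge0.
have scaleE F : mscale (NngNum fA0) P F = (P (X i0 @^-1` A) * P F)%E.
  by rewrite /mscale -[in RHS](fineK (fin_num_measure P _ mXA)).
rewrite -scaleE.
apply: (g_sigma_algebra_measure_unique boxes_without measurable_boxes_without
  (fun=> setT) (fun=> boxes_withoutT) _ (mrestr P mXA) (mscale (NngNum fA0) P)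
  boxes_withoutI) => //.
- by rewrite bigcup_const//; exists 0%N.
- by move=> F BF; rewrite [RHS]scaleE; exact: independent_box.
- move=> _; apply: le_lt_trans (_ : 1 < _)%E; last exact: ltry.
  by apply: probability_le1; exact: measurableI.
Qed.

Lemma measurable_frozen j (A : set R) : j != i0 -> measurable A ->
  (measurable : set (set frozen)) (X j @^-1` A).
Proof.
move=> ji0 mA; apply: sub_sigma_algebra.
exists (fun k => if k == j then A else setT).
  by move=> k; case: eqP.
apply/seteqP; split=> [w Aw k _|w /(_ j)] /=; first by case: eqP => [->|].
by rewrite eqxx; apply; rewrite /= !inE.
Qed.

Lemma measurable_fun_frozen j : j != i0 ->
  @measurable_fun _ _ frozen R setT (X j).
Proof.
by move=> ji0 _ A mA; rewrite setTI; exact: measurable_frozen.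
Qed.

Lemma measurable_id_frozen : @measurable_fun _ _ Omega frozen setT id.
Proof.
move=> _ A mA; rewrite setTI preimage_id.
have : <<s boxes_without >> `<=` @measurable _ Omega.
  apply: smallest_sub; first exact: sigma_algebra_measurable.
  exact: measurable_boxes_without.
exact.
Qed.

Let to_frozen : {mfun Omega >-> frozen} :=
  @mfun_Sub _ _ Omega frozen id (mem_set measurable_id_frozen).

(** On [R * frozen], the law of [w |-> (X i0 w, w)] is a product measure, so
    Fubini's theorem integrates the coordinate [X i0] first, all the others being
    frozen. *)
Lemma integral_freeze0 (f : R * frozen -> R) : measurable_fun setT f ->
  P.-integrable setT (fun w => (f (X i0 w, w))%:E) ->
  (forall w, \int[distribution P (X i0)]_t (f (t, w))%:E = 0)%E ->
  (\int[P]_w (f (X i0 w, w))%:E = 0)%E.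
Proof.
move=> mf intf f0.
have mXid : measurable_fun setT (fun w => (X i0 w, w) : R * frozen).
  by apply: measurable_fun_pair => //; exact: measurable_id_frozen.
pose Z : {mfun Omega >-> (R * frozen)%type} := mfun_Sub (mem_set mXid).
have eqZ B : measurable B -> distribution P Z B =
    (distribution P (X i0) \x distribution P to_frozen)%E B.
  move=> mB; apply/esym; apply: product_measure_unique => // A E mA mE.
  rewrite [RHS]/= /distribution /pushforward /= -(independent_frozen mA mE).
  by congr (P _); apply/seteqP; split => w /= [].
have mf' : measurable_fun setT (EFin \o f) by exact/measurable_EFinP.
transitivity (\int[distribution P Z]_z (f z)%:E)%E.
  by rewrite integral_distribution.
rewrite (eq_measure_integral (distribution P (X i0) \x distribution P to_frozen)%E); last first.
  by move=> B mB _; exact: eqZ.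
rewrite -integral21_prod_meas1.
  by apply: integral0_eq => w _; exact: f0.
have /integrableP[_ fin] : (distribution P Z).-integrable setT (EFin \o f).
  exact: integrable_pushforward.
apply/integrableP; split => //.
rewrite -(@eq_measure_integral _ _ _ _ _ (distribution P Z))//.
by move=> B mB _; exact: eqZ.
Qed.

End Freezing.

(** * Centered random variables *)

Section Centered.
Local Open Scope classical_set_scope.
Context {disp : measure_display} {Omega : measurableType disp} {R : realType}.
Variable P : probability Omega R.
Implicit Types f g : Omega -> R.

Definition centered f :=
  P.-integrable setT (EFin \o f) /\ (\int[P]_w (f w)%:E = 0)%E.

Lemma centered0 : centered (fun=> 0).
Proof. by split; [exact: integrable0|exact: integral0]. Qed.

Lemma centeredD f g : centered f -> centered g -> centered (fun w => f w + g w).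
Proof.
move=> [intf f0] [intg g0].
have intfg := integrableD measurableT intf intg.
split; first by apply: eq_integrable intfg.
by under eq_integral do rewrite EFinD; rewrite integralD// f0 g0 adde0.
Qed.

Lemma centeredZ (c : R) f : centered f -> centered (fun w => c * f w).
Proof.
move=> [intf f0]; split.
  by apply: eq_integrable (integrableZl measurableT c intf).
by under eq_integral do rewrite EFinM; rewrite integralZl// f0 mule0.
Qed.

Lemma centered_sum I (r : seq I) (f : I -> Omega -> R) :
  (forall i, centered (f i)) -> centered (fun w => \sum_(i <- r) f i w).
Proof.
move=> cf; elim: r => [|i r ih].
  by under eq_fun do rewrite big_nil; exact: centered0.
by under eq_fun do rewrite big_cons; exact: centeredD.
Qed.

Lemma centered_measurable f : centered f -> measurable_fun setT f.
Proof. by case=> /measurable_int /measurable_EFinP. Qed.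

Lemma centered_mulmxl p q r (A : 'M[R]_(p, q)) (F : Omega -> 'M[R]_(q, r)) :
  (forall i j, centered (fun w => F w i j)) ->
  forall i j, centered (fun w => (A *m F w) i j).
Proof.
move=> cF i j; under eq_fun do rewrite mxE.
by apply: centered_sum => k; exact: centeredZ.
Qed.

Lemma centered_mulmxr p q r (A : 'M[R]_(q, r)) (F : Omega -> 'M[R]_(p, q)) :
  (forall i j, centered (fun w => F w i j)) ->
  forall i j, centered (fun w => (F w *m A) i j).
Proof.
move=> cF i j; under eq_fun do rewrite mxE.
apply: centered_sum => k; under eq_fun do rewrite mulrC.
exact: centeredZ.
Qed.

Lemma centered_mxtrace p (F : Omega -> 'M[R]_p) :
  (forall i j, centered (fun w => F w i j)) -> centered (fun w => \tr (F w)).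
Proof. by move=> cF; apply: centered_sum => i; exact: cF. Qed.

Lemma integral_cst_centered (c : R) f :
  centered f -> (\int[P]_w (c + f w)%:E = c%:E)%E.
Proof.
move=> [intf f0]; under eq_integral do rewrite EFinD.
rewrite integralD//; last exact: finite_measure_integrable_cst.
by rewrite f0 adde0 integral_cst//= probability_setT mule1.
Qed.

(** Expectations are bounded by comparing pointwise with a centered variable. *)
Lemma integral_le_centered (c : R) f g :
  (forall w, 0 <= g w) -> measurable_fun setT g -> centered f ->
  (forall w, g w <= c + f w) -> (\int[P]_w (g w)%:E <= c%:E)%E.
Proof.
move=> g0 mg cf gle; rewrite -(integral_cst_centered c cf).
apply: ge0_le_integral => //.
- by move=> w _; rewrite lee_fin.
- exact/measurable_EFinP.
- apply/measurable_EFinP; apply: measurable_funD => //.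
  exact: centered_measurable.
- by move=> w _; rewrite lee_fin.
Qed.

Lemma centered_dominated (f_ : nat -> Omega -> R) f g :
  (forall k, centered (f_ k)) -> measurable_fun setT f ->
  P.-integrable setT (EFin \o g) ->
  {ae P, forall w, f_ ^~ w @ \oo --> f w} ->
  {ae P, forall w, forall k, `|f_ k w| <= g w} -> centered f.
Proof.
move=> cf mf intg fcvg fdom.
have [||||| intf _ lim] := @dominated_convergence _ Omega R P setT
  measurableT (fun k => EFin \o f_ k) (EFin \o f) (EFin \o g).
- by move=> k; apply/measurable_EFinP; exact: centered_measurable.
- exact/measurable_EFinP.
- apply: filterS fcvg => w fw _.
  by apply: cvg_EFin; [exact: nearW|exact: fw].
- exact: intg.
- by apply: filterS fdom => w dw k _; rewrite /= lee_fin.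
split => //; apply: cvg_unique lim _ => //.
rewrite (_ : (fun _ => _) = fun=> 0%E); first exact: cvg_cst.
by apply/funext => k; have [_ ->] := cf k.
Qed.

(** By Fatou's lemma. *)
Lemma integral_limit_le (f_ : nat -> Omega -> R) f (c : R) :
  (forall k w, 0 <= f_ k w) -> (forall k, measurable_fun setT (f_ k)) ->
  measurable_fun setT f ->
  {ae P, forall w, f_ ^~ w @ \oo --> f w} ->
  (forall k, \int[P]_w (f_ k w)%:E <= c%:E)%E ->
  (\int[P]_w (f w)%:E <= c%:E)%E.
Proof.
move=> f0 mf_ mf fcvg fle.
have mf_E k : measurable_fun setT (EFin \o f_ k) by exact/measurable_EFinP.
rewrite (ae_eq_integral (fun w => limn_einf (fun k => (f_ k w)%:E)))//; last 3 first.
- exact/measurable_EFinP.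
- rewrite /limn_einf; apply: measurableT_comp => //.
  apply: measurable_fun_limn_esup => k.
  exact: measurableT_comp (mf_E k).
- apply: filterS fcvg => w fw _; rewrite /=.
  have fwE : (f_ k w)%:E @[k --> \oo] --> (f w)%:E.
    by apply: cvg_EFin; [exact: nearW|exact: fw].
  by have [] := cvg_limn_einf_sup fwE.
have f0E k w : [set: Omega] w -> (0 <= (EFin \o f_ k) w)%E.
  by rewrite /= lee_fin.
apply: le_trans (fatou P measurableT mf_E f0E) _.
rewrite limn_einf_lim; apply: lime_le; first exact: is_cvg_einfs.
apply: nearW => k; apply: le_trans (fle k); apply: ereal_inf_lbound.
by exists k => /=.
Qed.

End Centered.

(** * Stein's identity for a Gaussian sketch *)

(** The law of a real random variable and [normal_prob] live on two measurable
    structures of [R] with the same measurable sets; integrals are carried from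
    one to the other by the identity map. *)
Section NormalLaw.
Local Open Scope classical_set_scope.
Context {disp : measure_display} {Omega : measurableType disp} {R : realType}.
Variables (P : probability Omega R) (mean sd : R) (X : {RV P >-> R}).
Hypothesis normalX : has_normal_law mean sd X.

Let id_measurable : @measurable_fun _ _ (measurableTypeR R) R setT id.
Proof. by move=> _ A mA; rewrite setTI. Qed.

Let idR : {mfun measurableTypeR R >-> R} :=
  @mfun_Sub _ _ (measurableTypeR R) R id (mem_set id_measurable).

Let normalX' A : measurable A ->
  distribution P X A = distribution (normal_prob mean sd) idR A.
Proof. exact: normalX. Qed.

Lemma ge0_integral_normal_law (f : R -> \bar R) : measurable_fun setT f ->
  (forall t, 0 <= f t)%E ->
  (\int[distribution P X]_t f t = \int[normal_prob mean sd]_t f t)%E.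
Proof.
move=> mf f0.
rewrite (eq_measure_integral (distribution (normal_prob mean sd) idR)).
  by rewrite ge0_integral_distribution.
by move=> A mA _; exact: normalX'.
Qed.

Lemma integral_normal_law (f : R -> \bar R) : measurable_fun setT f ->
  (normal_prob mean sd).-integrable setT f ->
  (\int[distribution P X]_t f t = \int[normal_prob mean sd]_t f t)%E.
Proof.
move=> mf intf.
rewrite (eq_measure_integral (distribution (normal_prob mean sd) idR)).
  by rewrite integral_distribution.
by move=> A mA _; exact: normalX'.
Qed.

End NormalLaw.

Section MultivariateStein.
Local Open Scope classical_set_scope.
Context {disp : measure_display} {Omega : measurableType disp} {R : realType}.
Variables (P : probability Omega R) (m n : nat).
Variable S : 'I_m -> 'I_n -> {RV P >-> R}.
Hypothesis gaussS : gaussian_sketch S.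

(** Borel measurability on the space of matrices, tested on measurable families
    of matrices. *)
Definition borel_mx (F : 'M[R]_(m, n) -> R) :=
  forall d (T : measurableType d) (A : T -> 'M[R]_(m, n)),
    measurable_mx A -> measurable_fun setT (fun x => F (A x)).

Lemma measurable_sketch_mx : measurable_mx (sketch_mx S).
Proof. by move=> i j; under eq_fun do rewrite mxE; exact: measurable_funPT. Qed.

Let sd : R := Num.sqrt (m%:R^-1).

Lemma integrable_sketch_entry i j : P.-integrable setT (fun w => (S i j w)%:E).
Proof.
have sd0 : sd != 0.
  by rewrite sqrtr_eq0 -ltNge invr_gt0 ltr0n (leq_trans _ (ltn_ord i)).
have /integrableP[_ fin] := integrable_id_normal_prob sd0.
apply/integrableP; split; first exact/measurable_EFinP/measurable_funPT.
have mabs : measurable_fun setT (fun t : R => `|t%:E|%E).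
  by apply: measurableT_comp => //; exact: EFin_measurable.
move: fin; rewrite -(ge0_integral_normal_law (gaussS.2 i j))//.
  by rewrite ge0_integral_distribution.
Qed.

(** Freeze all the entries but [S i l] and integrate by parts in that entry. *)
Lemma sketch_stein (F dF : 'M[R]_(m, n) -> R) (C : R) i l :
  borel_mx F -> borel_mx dF ->
  (forall A, `|F A| <= C) -> (forall A, `|dF A| <= C) ->
  (forall A (t : R), is_derive t 1 (fun s => F (A + s *: delta_mx i l))
                                   (dF (A + t *: delta_mx i l))) ->
  (forall A, continuous (fun t : R => dF (A + t *: delta_mx i l))) ->
  centered P (fun w => S i l w * F (sketch_mx S w) -
                       m%:R^-1 * dF (sketch_mx S w)).
Proof.
move=> bF bdF FC dFC dFE cdF.
have m0 : (0 < m)%N := leq_ltn_trans (leq0n i) (ltn_ord i).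
have sd0 : sd != 0 by rewrite sqrtr_eq0 -ltNge invr_gt0 ltr0n.
have sd2 : sd ^+ 2 = m%:R^-1 by rewrite sqr_sqrtr// invr_ge0.
have C0 : 0 <= C := le_trans (normr_ge0 _) (FC 0).
pose X := fun ij : 'I_m * 'I_n => S ij.1 ij.2.
pose frozen := g_sigma_algebraType (boxes_without X (i, l)).
(* The entry [(i, l)] is cut out of the sketch and put back as a variable. *)
pose S0 (w : frozen) : 'M[R]_(m, n) :=
  \matrix_(i', l') if (i', l') == (i, l) then 0 else S i' l' w.
pose St (z : R * frozen) := S0 z.2 + z.1 *: delta_mx i l.
have StE w : St (S i l w, w) = sketch_mx S w.
  apply/matrixP => i' l'; rewrite !mxE -xpair_eqE.
  by case: eqP => [[-> ->]|_]; rewrite ?mulr1 ?add0r ?mulr0 ?addr0.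
have mS0 i' l' : measurable_fun setT (fun w => S0 w i' l').
  under eq_fun do rewrite mxE.
  case: (eqVneq (i', l') (i, l)) => [_|ne]; first exact: measurable_cst.
  exact: (measurable_fun_frozen (X := X) ne).
have mSt : measurable_mx St.
  apply: measurable_mxD.
    by move=> i' l'; exact: (measurableT_comp (mS0 i' l') measurable_snd).
  apply: measurable_mxZ => //; exact: measurable_mx_cst.
pose f (z : R * frozen) := z.1 * F (St z) - m%:R^-1 * dF (St z).
have mf : measurable_fun setT f.
  by apply: measurable_funB; apply: measurable_funM => //; [exact: bF|exact: bdF].
have fE w : f (S i l w, w) = S i l w * F (sketch_mx S w) - m%:R^-1 * dF (sketch_mx S w).
  by rewrite /f StE.
suff : centered P (fun w => f (X (i, l) w, w)).
  by congr (centered P _); apply/funext => w; exact: fE.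
have intf : P.-integrable setT (fun w => (f (X (i, l) w, w))%:E).
  apply: (@le_integrable _ Omega R P setT measurableT _
    (fun w => C%:E * `|(S i l w)%:E| + (m%:R^-1 * C)%:E)%E).
  - apply/measurable_EFinP; under eq_fun do rewrite fE.
    apply: measurable_funB; apply: measurable_funM => //.
      exact: bF measurable_sketch_mx.
    exact: bdF measurable_sketch_mx.
  - move=> w _; rewrite /X fE /= lee_fin [leRHS]ger0_norm; last first.
      by rewrite addr_ge0// mulr_ge0// invr_ge0.
    apply: le_trans (ler_normB _ _) _; rewrite !normrM [C * _]mulrC.
    by rewrite lerD// ?ler_wpM2l// ger0_norm ?invr_ge0// ler_wpM2l ?invr_ge0.
  - apply: integrableD => //; last exact: finite_measure_integrable_cst.
    apply: integrableZl => //; apply: integrable_abse.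
    exact: integrable_sketch_entry.
split => //.
apply: (integral_freeze0 gaussS.1 mf intf) => w.
have [] := @gaussian_stein _ sd sd0 (fun t => F (S0 w + t *: delta_mx i l))
  (fun t => dF (S0 w + t *: delta_mx i l)) C => //.
rewrite sd2 => intfw f0; rewrite (integral_normal_law (gaussS.2 i l))//.
by apply/measurable_EFinP; exact: measurable_fun_pair1.
Qed.

End MultivariateStein.

Section BoundedFunctions.
Local Open Scope classical_set_scope.
Context {T : Type} {R : realType}.
Implicit Types F G : T -> R.

Definition bounded_map F := exists C, forall x, `|F x| <= C.

Lemma bounded_map_cst (c : R) : bounded_map (fun=> c).
Proof. by exists `|c|. Qed.

Lemma bounded_mapD F G :
  bounded_map F -> bounded_map G -> bounded_map (fun x => F x + G x).
Proof.
move=> [C FC] [C' GC]; exists (C + C') => x.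
by apply: le_trans (ler_normD _ _) _; rewrite lerD.
Qed.

Lemma bounded_mapN F : bounded_map F -> bounded_map (fun x => - F x).
Proof. by move=> [C FC]; exists C => x; rewrite normrN. Qed.

Lemma bounded_mapM F G :
  bounded_map F -> bounded_map G -> bounded_map (fun x => F x * G x).
Proof.
move=> [C FC] [C' GC]; exists (C * C') => x.
by rewrite normrM ler_pM.
Qed.

End BoundedFunctions.

Section CenteredMatrices.
Local Open Scope classical_set_scope.
Context {disp : measure_display} {Omega : measurableType disp} {R : realType}.
Variable P : probability Omega R.

Definition centered_mx p q (F : Omega -> 'M[R]_(p, q)) :=
  forall i j, centered P (fun w => F w i j).

Lemma eq_centered_mx p q (F F' : Omega -> 'M[R]_(p, q)) :
  (forall w, F w = F' w) -> centered_mx F -> centered_mx F'.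
Proof. by move=> /funext ->. Qed.

End CenteredMatrices.

(** * Stein's identity for the regularized hat matrix *)

Section SketchedHatStein.
Local Open Scope classical_set_scope.
Context {R : realType}.
Variables (m n d : nat) (H : 'M[R]_(n, d)).
Hypothesis full_rank : \rank H = d.
Implicit Types (A : 'M[R]_(m, n)).

Lemma mul_delta_mx_entry p q r s (A : 'M[R]_(p, q)) (B : 'M[R]_(r, s)) k l i j :
  (A *m delta_mx k l *m B) i j = A i k * B l j.
Proof.
rewrite -mulmxA mxE (bigD1 k)//= big1 ?addr0 => [|k' nk].
  rewrite mxE (bigD1 l)//= big1 ?addr0 => [|l' nl].
    by rewrite mxE !eqxx mul1r.
  by rewrite mxE (negbTE nl) andbF mul0r.
rewrite mxE big1 ?mulr0// => l' _.
by rewrite mxE (negbTE nk) mul0r.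
Qed.

Lemma measurable_sketched_hat e d' (T : measurableType d') (A : T -> 'M[R]_(m, n)) :
  measurable_mx A -> measurable_mx (fun x => sketched_hat H e (A x)).
Proof.
move=> mA; rewrite /sketched_hat; under eq_fun do rewrite hatmxE.
apply: measurable_mxM; last exact: measurable_mx_cst.
apply: measurable_mxM; first exact: measurable_mx_cst.
apply: measurable_adjinv.
apply: measurable_mxM; last exact: measurable_mx_cst.
apply: measurable_mxM; first exact: measurable_mx_cst.
apply: measurable_mxD; last exact: measurable_mx_cst.
by apply: measurable_mxM => //; exact: measurable_mx_tr.
Qed.

Variable e : R.
Hypothesis e_gt0 : 0 < e.
Local Notation N := (sketched_hat H e).

Let det_e A : \det (H^T *m (A^T *m A + e%:M) *m H) != 0.
Proof. exact: regularized_det. Qed.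

Lemma bounded_sketched_hat i j : bounded_map (fun A => N A i j).
Proof.
exists (d%:R / e) => A; rewrite ler_pdivlMr// mulrC.
apply: le_trans (tr_sketched_hat_le (det_e A) (ltW e_gt0)).
by rewrite ler_wpM2l ?(ltW e_gt0)// (sketched_hat_entry (det_e A) (ltW e_gt0)).
Qed.

Lemma bounded_sketch_hat i j : bounded_map (fun A => (A *m N A) i j).
Proof.
exists (1 + d%:R / e) => A.
have x2 := sketch_hat_sqr_le (det_e A) (ltW e_gt0) i j.
have tr_le : \tr (N A) <= d%:R / e.
  by rewrite ler_pdivlMr// mulrC (tr_sketched_hat_le (det_e A) (ltW e_gt0)).
have := sqr_ge0 (`|(A *m N A) i j| - 1).
by move: x2; rewrite -(real_normK (num_real ((A *m N A) i j))); nra.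
Qed.

Lemma bounded_sketch_conj i : bounded_map (fun A => (A *m N A *m A^T) i i).
Proof.
exists d%:R => A.
by have /andP[ge0 le_d] := sketch_conj_diag (det_e A) (ltW e_gt0) i; rewrite ger0_norm.
Qed.

Section Line.
Variables (A : 'M[R]_(m, n)) (i : 'I_m) (l : 'I_n) (t : R).
Let L s := A + s *: delta_mx i l.
Let D : 'M[R]_(m, n) := delta_mx i l.

Let is_derive_hat_mx : is_derive_mx t (fun s => N (L s))
  (- (N (L t) *m (D^T *m L t + (L t)^T *m D) *m N (L t))).
Proof.
have dL : is_derive_mx t L D by exact: is_derive_mx_line.
have dQ := is_derive_mxM (is_derive_mx_tr dL) dL.
have dM := is_derive_mxD dQ (is_derive_mx_cst t e%:M).
by rewrite addr0 in dM; exact: is_derive_hatmx dM (fun s => det_e (L s)).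
Qed.

(** [N' = - N (S^T S)' N], and [S' = delta_mx i l] along the line. *)
Lemma is_derive_sketched_hat q r : is_derive t 1 (fun s => N (L s) q r)
  (- (N (L t) q l * (L t *m N (L t)) i r + (L t *m N (L t)) i q * N (L t) l r)).
Proof.
apply: is_derive_eq (is_derive_hat_mx q r) _.
rewrite mxE mulmxDr mulmxDl mxE; congr (- (_ + _)).
  by rewrite trmx_delta -2!mulmxA mulmxA mul_delta_mx_entry.
rewrite mulmxA mul_delta_mx_entry; congr (_ * _).
by rewrite -{1}(trmx_sketched_hat (det_e (L t))) -trmx_mul mxE.
Qed.

Lemma is_derive_sketch_hat p : is_derive t 1 (fun s => (L s *m N (L s)) i p)
  (N (L t) l p - (L t *m N (L t)) i l * (L t *m N (L t)) i p
               - (L t *m N (L t) *m (L t)^T) i i * N (L t) l p).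
Proof.
have dL : is_derive_mx t L D by exact: is_derive_mx_line.
apply: is_derive_eq (is_derive_mxM dL is_derive_hat_mx i p) _.
rewrite mulmxN mxE [X in _ + X]mxE -addrA -opprD; congr (_ - _).
  by rewrite -[D]mul1mx mul_delta_mx_entry mxE eqxx mul1r.
rewrite mulmxDr mulmxDl mulmxDr mxE; congr (_ + _).
  by rewrite trmx_delta !mulmxA -(mulmxA _ (L t)) mul_delta_mx_entry.
by rewrite !mulmxA mul_delta_mx_entry.
Qed.

Lemma derivable_sketch_conj j :
  derivable (fun s => (L s *m N (L s) *m (L s)^T) j j) t 1.
Proof.
have dL : is_derive_mx t L D by exact: is_derive_mx_line.
have dLN := is_derive_mxM dL is_derive_hat_mx.
exact: (is_derive_mx_derivable (is_derive_mxM dLN (is_derive_mx_tr dL))).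
Qed.

End Line.

Lemma is_derive_continuous (f df : R -> R) :
  (forall t : R, is_derive t 1 f (df t)) -> continuous f.
Proof.
move=> dfE t; apply/differentiable_continuous/derivable1_diffP.
by have [] := dfE t.
Qed.

Context {disp : measure_display} {Omega : measurableType disp}.
Variables (P : probability Omega R) (S : 'I_m -> 'I_n -> {RV P >-> R}).
Hypothesis gaussS : gaussian_sketch S.
Local Notation Sm := (sketch_mx S).

(** [sketch_stein] for the field [(A N)_ip (a + b N_qr)]: the choice [a = 1],
    [b = 0] leads to the first moment, [a = 0], [b = 1] to the second ones. *)
Lemma sketched_hat_stein i l p q r (a b : R) :
  centered P (fun w => let A := Sm w in
    A i l * ((A *m N A) i p * (a + b * N A q r)) -
    m%:R^-1 * ((N A l p - (A *m N A) i l * (A *m N A) i p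
                        - (A *m N A *m A^T) i i * N A l p) * (a + b * N A q r)
      - b * (A *m N A) i p * (N A q l * (A *m N A) i r + (A *m N A) i q * N A l r))).
Proof.
pose F A := (A *m N A) i p * (a + b * N A q r).
pose dF A := (N A l p - (A *m N A) i l * (A *m N A) i p
                        - (A *m N A *m A^T) i i * N A l p) * (a + b * N A q r)
      - b * (A *m N A) i p * (N A q l * (A *m N A) i r + (A *m N A) i q * N A l r).
have bN := bounded_sketched_hat; have bSN := bounded_sketch_hat.
have bF : bounded_map F.
  apply: bounded_mapM; first exact: bSN.
  apply: bounded_mapD; first exact: bounded_map_cst.
  by apply: bounded_mapM; [exact: bounded_map_cst|exact: bN].
have bdF : bounded_map dF.
  apply: bounded_mapD.
    apply: bounded_mapM.
      apply: bounded_mapD.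
        by apply: bounded_mapD; [|apply/bounded_mapN/bounded_mapM].
      apply/bounded_mapN/bounded_mapM => //; exact: bounded_sketch_conj.
    apply: bounded_mapD; first exact: bounded_map_cst.
    by apply: bounded_mapM; [exact: bounded_map_cst|exact: bN].
  apply/bounded_mapN/bounded_mapM.
    by apply: bounded_mapM; [exact: bounded_map_cst|exact: bSN].
  by apply: bounded_mapD; apply: bounded_mapM.
have [C1 FC1] := bF; have [C2 dFC2] := bdF.
have mE d' (T : measurableType d') (A : T -> 'M[R]_(m, n)) : measurable_mx A ->
    [/\ measurable_mx (fun x => N (A x)), measurable_mx (fun x => A x *m N (A x)) &
        measurable_mx (fun x => A x *m N (A x) *m (A x)^T)].
  move=> mA; have mN := measurable_sketched_hat e mA.
  have mAN := measurable_mxM mA mN.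
  by split => //; apply: measurable_mxM => //; exact: measurable_mx_tr.
have borelF : borel_mx F.
  move=> d' T A /mE[mN mAN _]; apply: measurable_funM; first exact: mAN.
  by apply: measurable_funD => //; apply: measurable_funM => //; exact: mN.
have boreldF : borel_mx dF.
  move=> d' T A /mE[mN mAN mANA].
  apply: measurable_funB; apply: measurable_funM.
  - apply: measurable_funB; last exact: measurable_funM (mANA _ _) (mN _ _).
    by apply: measurable_funB; [exact: mN|exact: measurable_funM (mAN _ _) (mAN _ _)].
  - by apply: measurable_funD => //; apply: measurable_funM => //; exact: mN.
  - by apply: measurable_funM => //; exact: mAN.
  - apply: measurable_funD; first exact: measurable_funM (mN _ _) (mAN _ _).
    exact: measurable_funM (mAN _ _) (mN _ _).
have dFE A (t : R) : is_derive t 1 (fun s => F (A + s *: delta_mx i l))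
    (dF (A + t *: delta_mx i l)).
  have dN := is_derive_sketched_hat A i l t q r.
  have dSN := is_derive_sketch_hat A i l t p.
  apply: is_derive_eq; rewrite /dF /GRing.scale/=; ring.
have cdF A : continuous (fun t : R => dF (A + t *: delta_mx i l)).
  have cN q' r' := is_derive_continuous
    (fun t => is_derive_sketched_hat A i l t q' r').
  have cSN p' := is_derive_continuous (fun t => is_derive_sketch_hat A i l t p').
  have cSNS : continuous
      (fun t : R => ((A + t *: delta_mx i l) *m N (A + t *: delta_mx i l)
         *m (A + t *: delta_mx i l)^T) i i).
    move=> t; apply/differentiable_continuous/derivable1_diffP.
    exact: derivable_sketch_conj.
  move=> t; apply: cvgB; apply: cvgM.
  - apply: cvgB; last by apply: cvgM; [exact: cSNS|exact: cN].
    by apply: cvgB; [exact: cN|apply: cvgM; exact: cSN].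
  - by apply: cvgD; [exact: cvg_cst|apply: cvgM; [exact: cvg_cst|exact: cN]].
  - by apply: cvgM; [exact: cvg_cst|exact: cSN].
  - by apply: cvgD; apply: cvgM; (exact: cN || exact: cSN).
have := @sketch_stein _ _ _ _ _ _ S gaussS F dF (Num.max C1 C2) i l borelF boreldF.
have FC A : `|F A| <= Num.max C1 C2 by rewrite le_max FC1.
have dFC A : `|dF A| <= Num.max C1 C2 by rewrite le_max dFC2 orbT.
move=> /(_ FC dFC dFE cdF); congr (centered P _); apply/funext => w.
by rewrite /F /dF [X in _ = X * _ - _]mxE.
Qed.

End SketchedHatStein.

(** * Moment identities at a fixed regularization *)

Section RegularizedMoments.
Local Open Scope classical_set_scope.
Context {disp : measure_display} {Omega : measurableType disp} {R : realType}.
Variables (P : probability Omega R) (m n d : nat) (H : 'M[R]_(n, d)).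
Variable S : 'I_m -> 'I_n -> {RV P >-> R}.
Hypothesis full_rank : \rank H = d.
Hypothesis gaussS : gaussian_sketch S.

Local Notation Pi := (hatmx H 1%:M).
Local Notation Sm := (sketch_mx S).
Local Notation s := (m%:R^-1 : R).
Local Notation c := (m%:R - d%:R : R).

Section FixedRegularization.
Variable e : R.
Hypothesis e_gt0 : 0 < e.
Let N w := sketched_hat H e (Sm w).
Let N2 w := N w *m N w.
Let N3 w := N w *m N w *m N w.
Let G w := N w - e *: N2 w.
Let QN w := (Sm w)^T *m (Sm w *m N w).

Let det_e w : \det (H^T *m ((Sm w)^T *m Sm w + e%:M) *m H) != 0.
Proof. exact: regularized_det. Qed.

Let gramE w : (Sm w *m N w)^T *m (Sm w *m N w) = G w.
Proof. exact: sketched_hat_gram. Qed.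

Let NC w i j : N w i j = N w j i.
Proof. exact: sketched_hatC. Qed.

Let PiQN w : Pi *m QN w = Pi - e *: N w.
Proof.
rewrite /QN !mulmxA -(mulmxA Pi).
exact: (hat1_mul_gram_sketched_hat full_rank (det_e w)).
Qed.

Let PiN w : Pi *m N w = N w.
Proof. exact: (hat1_mul_hatmx full_rank). Qed.

Let PiG w : Pi *m G w = G w.
Proof. by rewrite /G /N2 mulmxBr -scalemxAr mulmxA PiN. Qed.

(** Sum of [sketched_hat_stein] over the rows [i] of the sketch: the sums of
    products of entries of [A N] are entries of [G = (A N)^T (A N)]. *)
Lemma stein_tensor l p q r (a b : R) :
  centered P (fun w => QN w l p * (a + b * N w q r) -
    s * (((m%:R - (d%:R - e * \tr (N w))) * N w l p - G w l p) * (a + b * N w q r)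
         - b * (N w l q * G w p r + G w p q * N w l r))).
Proof.
have cS : centered P _ := centered_sum (index_enum 'I_m)
  (fun i => sketched_hat_stein full_rank e_gt0 gaussS i l p q r a b).
move: cS; congr (centered P _); apply/funext => w /=; rewrite -/(N w).
set A := Sm w; set X := A *m N w.
have QE : QN w l p = \sum_i A i l * X i p.
  by rewrite /QN mxE; apply: eq_bigr => i _; rewrite mxE.
have GE j k : G w j k = \sum_i X i j * X i k.
  by rewrite -gramE mxE; apply: eq_bigr => i _; rewrite mxE.
have YE : d%:R - e * \tr (N w) = \sum_i (X *m A^T) i i.
  by rewrite -(mxtrace_sketch_conj (det_e w)).
have mE : m%:R = \sum_(i < m) 1 :> R by rewrite sumr_const card_ord.
set x := a + b * N w q r; rewrite YE QE !GE (NC w l q).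
move: (m%:R^-1) => k; rewrite mE.
transitivity (\sum_i (x * (A i l * X i p) + - (k * x * N w l p) * 1 +
   k * x * (X i l * X i p) + k * x * N w l p * (X *m A^T) i i +
   k * b * N w q l * (X i p * X i r) + k * b * N w l r * (X i p * X i q))).
  by apply: eq_bigr => i _; ring.
rewrite !big_split /= -!mulr_sumr; ring.
Qed.

(** [stein_tensor] with a constant second factor, projected by [Pi]. *)
Lemma centered_first : centered_mx P (fun w =>
  Pi - e *: N w - s *: ((c - 1) *: N w + e *: N2 w + (e * \tr (N w)) *: N w)).
Proof.
have := centered_mulmxl Pi (F := fun w => QN w -
    s *: ((m%:R - (d%:R - e * \tr (N w))) *: N w - G w)).
move=> /(_ P) cPi; apply: eq_centered_mx (cPi _) => [w|l p]; last first.
  have := stein_tensor l p p p 1 0; congr (centered P _); apply/funext => w.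
  by rewrite !mxE !mul0r !addr0 !mulr1 subr0.
rewrite mulmxBr PiQN -scalemxAr mulmxBr -scalemxAr PiN PiG /G /N2.
by apply/matrixP => i j; move: (N w *m N w) => NN; rewrite !mxE; ring.
Qed.

(** Contraction [p = q] of [stein_tensor], projected by [Pi]. *)
Lemma centered_second_a : centered_mx P (fun w =>
  N w - e *: N2 w - s *: ((c - 2) *: N2 w + (2 * e) *: N3 w
    + (e * \tr (N w)) *: N2 w + (e * \tr (N2 w)) *: N w - \tr (N w) *: N w)).
Proof.
have := centered_mulmxl Pi (F := fun w => QN w *m N w -
    s *: (((m%:R - (d%:R - e * \tr (N w))) *: N w - G w) *m N w
      - N w *m G w - \tr (G w) *: N w)).
move=> /(_ P) cPi; apply: eq_centered_mx (cPi _) => [w|l r]; last first.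
  have cS : centered P _ := centered_sum (index_enum 'I_n)
    (fun p => stein_tensor l p p r 0 1).
  move: cS; congr (centered P _); apply/funext => w.
  set Z := _ - G w; rewrite !mxE.
  have -> : \tr (G w) = \sum_p G w p p by [].
  transitivity (\sum_p (QN w l p * N w p r + - s * (Z l p * N w p r)
    + s * (N w l p * G w p r) + s * N w l r * G w p p)).
    by apply: eq_bigr => p _; rewrite /Z !mxE; ring.
  by rewrite !big_split /= -!mulr_sumr; ring.
rewrite mulmxBr (mulmxA Pi (QN w)) PiQN -[Pi *m (s *: _)]scalemxAr.
rewrite 2!(mulmxBr Pi) !(mulmxA Pi) (mulmxBr Pi) -!(scalemxAr _ Pi) PiN PiG.
have -> : \tr (G w) = \tr (N w) - e * \tr (N2 w).
  by rewrite /G linearB linearZ.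
rewrite /G /N3 /N2 !(mulmxBl, mulmxBr) -!scalemxAl -!scalemxAr PiN !mulmxA.
apply/matrixP => i j; move: (\tr (N w *m N w)) (N w *m N w *m N w) (N w *m N w) => t2 NNN NN.
by rewrite !mxE; ring.
Qed.

(** Contraction [q = r] of [stein_tensor], projected by [Pi]. *)
Lemma centered_second_b : centered_mx P (fun w =>
  \tr (N w) *: (Pi - e *: N w) - s *: (\tr (N w) *: ((c - 1) *: N w + e *: N2 w
    + (e * \tr (N w)) *: N w) - 2 *: N2 w + (2 * e) *: N3 w)).
Proof.
have := centered_mulmxl Pi (F := fun w => \tr (N w) *: QN w -
    s *: (\tr (N w) *: ((m%:R - (d%:R - e * \tr (N w))) *: N w - G w)
      - 2 *: (N w *m G w))).
move=> /(_ P) cPi; apply: eq_centered_mx (cPi _) => [w|l p]; last first.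
  have cS : centered P _ := centered_sum (index_enum 'I_n)
    (fun q => stein_tensor l p q q 0 1).
  move: cS; congr (centered P _); apply/funext => w.
  set Z := _ - G w.
  have GC j k : G w j k = G w k j.
    by rewrite -gramE !mxE; apply: eq_bigr => i _; rewrite !mxE mulrC.
  have trE : \tr (N w) = \sum_q N w q q by [].
  transitivity (\sum_q (QN w l p * N w q q + - s * Z l p * N w q q
    + s * 2 * (N w l q * G w q p))).
    by apply: eq_bigr => q _; rewrite (GC p q) /Z !mxE; ring.
  rewrite !big_split/= -!mulr_sumr -trE.
  have -> : \sum_q N w l q * G w q p = (N w *m G w) l p by rewrite [RHS]mxE.
  by move: (N w *m G w) => NG; rewrite /Z !mxE; ring.
rewrite mulmxBr -!scalemxAr PiQN mulmxBr -!scalemxAr mulmxBr -scalemxAr mulmxA PiN PiG.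
rewrite /G /N3 /N2 mulmxBr -scalemxAr mulmxA.
apply/matrixP => i j; move: (N w *m N w *m N w) (N w *m N w) => NNN NN.
by rewrite !mxE; ring.
Qed.

End FixedRegularization.

End RegularizedMoments.

(** * Uniform bounds and the limit of vanishing regularization *)

Section InverseMoments.
Local Open Scope classical_set_scope.
Context {disp : measure_display} {Omega : measurableType disp} {R : realType}.
Variables (P : probability Omega R) (m n d : nat) (H : 'M[R]_(n, d)).
Variable S : 'I_m -> 'I_n -> {RV P >-> R}.
Hypothesis full_rank : \rank H = d.
Hypothesis gaussS : gaussian_sketch S.

Local Notation Pi := (hatmx H 1%:M).
Local Notation Sm := (sketch_mx S).
Local Notation c := (m%:R - d%:R : R).
Let N e w := sketched_hat H e (Sm w).
Let t e w := \tr (N e w).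
Let N2 e w := N e w *m N e w.
Let N3 e w := N e w *m N e w *m N e w.
Let nonsingular w := \det (H^T *m ((Sm w)^T *m Sm w) *m H) != 0.

Let det_e e w : 0 < e -> \det (H^T *m ((Sm w)^T *m Sm w + e%:M) *m H) != 0.
Proof. exact: regularized_det. Qed.

Let mN e : measurable_mx (N e).
Proof. exact/measurable_sketched_hat/measurable_sketch_mx. Qed.

Let mt e : measurable_fun setT (t e).
Proof. exact: measurable_mxtrace. Qed.

Let clear_denominator (u a b : R) : (0 < m)%N ->
  m%:R * u * (a - m%:R^-1 * b) = u * (m%:R * a - b).
Proof.
move=> m0; have m0' : m%:R != 0 :> R by rewrite pnatr_eq0 -lt0n.
by rewrite mulrBr mulrA [m%:R * u]mulrC -!mulrA mulVKf// -mulrBr.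
Qed.

Let trB p (A B : 'M[R]_p) : \tr (A - B) = \tr A - \tr B.
Proof. exact: raddfB. Qed.

Lemma regularized_first e i j : (0 < m)%N -> 0 < e -> centered P (fun w =>
  m%:R * (Pi i j - e * N e w i j)
  - ((c - 1) * N e w i j + e * N2 e w i j + e * t e w * N e w i j)).
Proof.
move=> m0 e0.
have := centeredZ (m%:R * 1) (centered_first full_rank gaussS e0 i j).
congr (centered P _); apply/funext => w; rewrite -/(N e w) -/(t e w) -/(N2 e w).
move: (N2 e w) (N e w) (t e w) => y x tt.
by rewrite !mxE clear_denominator// mul1r.
Qed.

(** [c - 1] times the first second-order identity plus the second one: the
    product of [N] with its trace is eliminated, up to terms in [e]. *)
Lemma regularized_second e i j : (0 < m)%N -> 0 < e -> centered P (fun w =>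
  m%:R * ((c - 1) * (N e w i j - e * N2 e w i j) + t e w * (Pi i j - e * N e w i j))
  - (c * (c - 3) * N2 e w i j + 2 * c * (e * N3 e w i j) + c * (e * t e w * N2 e w i j)
     + (c - 1) * (e * \tr (N2 e w) * N e w i j) + e * t e w * t e w * N e w i j)).
Proof.
move=> m0 e0.
have ca := centered_second_a full_rank gaussS e0 i j.
have cb := centered_second_b full_rank gaussS e0 i j.
have := centeredD (centeredZ (m%:R * (c - 1)) ca) (centeredZ (m%:R * 1) cb).
congr (centered P _); apply/funext => w.
rewrite -/(N e w) -/(t e w) -/(N2 e w) -/(N3 e w).
move: (N2 e w) (N3 e w) (N e w) (t e w) => y z x tt.
by rewrite !mxE !clear_denominator//; ring.
Qed.

Lemma regularized_trace_first e : (0 < m)%N -> 0 < e -> centered P (fun w =>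
  m%:R * (d%:R - e * t e w)
  - ((c - 1) * t e w + e * \tr (N2 e w) + e * t e w ^+ 2)).
Proof.
move=> m0 e0; have := centered_sum (index_enum 'I_n)
  (fun i => regularized_first i i m0 e0).
congr (centered P _); apply/funext => w.
rewrite -(mxtrace_hat1 full_rank) sumrB -!mulr_sumr sumrB !big_split/=.
by rewrite -!mulr_sumr -/(\tr _) -/(\tr (N e w)) -/(\tr (N2 e w)) -/(t e w) expr2 mulrA.
Qed.

(** Twice the first second-order identity plus [c - 2] times the second one: the
    trace of [N^2] is eliminated, up to terms in [e]. *)
Lemma regularized_trace_second e : (0 < m)%N -> 0 < e -> centered P (fun w =>
  m%:R * (2 * (t e w - e * \tr (N2 e w)) + (c - 2) * (t e w * (d%:R - e * t e w)))
  - (c * (c - 3) * t e w ^+ 2 + 2 * c * (e * \tr (N3 e w))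
     + (c + 2) * (e * t e w * \tr (N2 e w)) + (c - 2) * (e * t e w ^+ 3))).
Proof.
move=> m0 e0.
have ca := centered_mxtrace (centered_second_a full_rank gaussS e0).
have cb := centered_mxtrace (centered_second_b full_rank gaussS e0).
have := centeredD (centeredZ (m%:R * 2) ca) (centeredZ (m%:R * (c - 2)) cb).
congr (centered P _); apply/funext => w.
rewrite -/(N e w) -/(t e w) -/(N2 e w) -/(N3 e w).
rewrite !(trB, mxtraceD, mxtraceZ) (mxtrace_hat1 full_rank) -/(t e w).
move: (\tr (N2 e w)) (\tr (N3 e w)) (t e w) => y z x.
by rewrite !clear_denominator//; ring.
Qed.

(** In [regularized_trace_first], every term in [e] is nonpositive. *)
Lemma integral_trace_le e : (d + 1 < m)%N -> 0 < e ->
  (\int[P]_w (t e w)%:E <= (m%:R * d%:R / (c - 1))%:E)%E.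
Proof.
move=> dm e0; have c1 : 0 < c - 1.
  by have := dm; rewrite -(ltr_nat R) natrD; lra.
have m0 : (0 < m)%N by apply: leq_ltn_trans dm.
apply: (integral_le_centered _ _ (centeredZ (- (c - 1)^-1) (regularized_trace_first m0 e0))).
- by move=> w; exact: tr_sketched_hat_ge0 (det_e _ e0) (ltW e0).
- exact: mt.
- move=> w; rewrite mulNr -[X in _ <= _ - X]mulrC -mulrBl ler_pdivlMr//.
  have t0 : 0 <= t e w := tr_sketched_hat_ge0 (det_e _ e0) (ltW e0).
  have t20 : 0 <= \tr (N2 e w) := tr_sketched_hat2_ge0 (det_e _ e0).
  have et := mulr_ge0 (ltW e0) t0; have et2 := mulr_ge0 (ltW e0) t20.
  have ett := mulr_ge0 (ltW e0) (sqr_ge0 (t e w)).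
  have met := mulr_ge0 (ler0n R m) et.
  lra.
Qed.

(** In [regularized_trace_second], every term in [e] is nonpositive, and the term
    of degree one in the trace is bounded by [regularized_trace_first]. *)
Lemma integral_sqr_trace_le : (d + 3 < m)%N -> exists C : R, forall e, 0 < e ->
  (\int[P]_w (t e w ^+ 2)%:E <= C%:E)%E.
Proof.
move=> dm; have c3 : 0 < c - 3.
  by have := dm; rewrite -(ltr_nat R) natrD; lra.
have m0 : (0 < m)%N by apply: leq_ltn_trans dm.
(* [k] is the multiple of the first identity that cancels the linear term. *)
pose k := m%:R * (2 + (c - 2) * d%:R) / (c - 1); pose l := c * (c - 3).
have l0 : 0 < l by rewrite mulr_gt0//; lra.
have c1 : 0 < c - 1 by lra.
have k0 : 0 <= k.
  by rewrite divr_ge0 ?(ltW c1)// mulr_ge0// addr_ge0// mulr_ge0//; lra.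
exists (k * (m%:R * d%:R) / l) => e e0.
apply: (integral_le_centered _ _ (centeredZ (- l^-1) (centeredD
  (centeredZ k (regularized_trace_first m0 e0)) (regularized_trace_second m0 e0)))).
- by move=> w; exact: sqr_ge0.
- exact: measurable_funX.
- move=> w; rewrite mulNr -[X in _ <= _ - X]mulrC -mulrBl ler_pdivlMr//.
  have t0 : 0 <= t e w := tr_sketched_hat_ge0 (det_e _ e0) (ltW e0).
  have t20 : 0 <= \tr (N2 e w) := tr_sketched_hat2_ge0 (det_e _ e0).
  have t30 : 0 <= \tr (N3 e w) := tr_sketched_hat3_ge0 (det_e _ e0) (ltW e0).
  move: (t e w) (\tr (N2 e w)) (\tr (N3 e w)) t0 t20 t30 => x y z x0 y0 z0.
  have kc : k * (c - 1) = m%:R * (2 + (c - 2) * d%:R) by rewrite /k divfK// gt_eqF.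
  have e0' := ltW e0; have mR := ler0n R m.
  have -> : k * (m%:R * d%:R) - (k * (m%:R * (d%:R - e * x) -
      ((c - 1) * x + e * y + e * x ^+ 2)) + (m%:R * (2 * (x - e * y) +
      (c - 2) * (x * (d%:R - e * x))) - (c * (c - 3) * x ^+ 2 + 2 * c * (e * z) +
      (c + 2) * (e * x * y) + (c - 2) * (e * x ^+ 3)))) =
    x ^+ 2 * l + (k * (m%:R * (e * x) + e * y + e * x ^+ 2) +
      m%:R * (2 * (e * y) + (c - 2) * (e * x ^+ 2)) + 2 * c * (e * z) +
      (c + 2) * (e * x * y) + (c - 2) * (e * x ^+ 3)) +
      (k * (c - 1) - m%:R * (2 + (c - 2) * d%:R)) * x.
    by rewrite /l; ring.
  rewrite kc subrr mul0r addr0 lerDl.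
  have c2 : 0 <= c - 2 by lra.
  have c0 : 0 <= c by lra.
  have c20 : 0 <= c + 2 by lra.
  by repeat first [exact: c2 | exact: c0 | exact: c20 | done | apply: addr_ge0
    | apply: mulr_ge0 | apply: exprn_ge0].
Qed.

(** On the singular event [1 <= e n t], so its probability is at most [e] times a
    constant, for every [e > 0]. *)
Lemma ae_nonsingular : (d + 1 < m)%N -> {ae P, forall w, nonsingular w}.
Proof.
move=> dm.
pose B := [set w | \det (H^T *m ((Sm w)^T *m Sm w) *m H) = 0].
have mS := measurable_sketch_mx S.
have mdet : measurable_fun setT
    (fun w => \det (H^T *m ((Sm w)^T *m Sm w) *m H)).
  apply: measurable_det; apply: measurable_mxM; last exact: measurable_mx_cst.
  apply: measurable_mxM; first exact: measurable_mx_cst.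
  by apply: measurable_mxM => //; exact: measurable_mx_tr.
have mB : measurable B.
  by have := mdet measurableT _ (measurable_set1 0); rewrite setTI.
pose K := n%:R * (m%:R * d%:R / (c - 1)).
have PB e : 0 < e -> (P B <= (e * K)%:E)%E.
  move=> e0; rewrite -[B]setIT -integral_indic//.
  apply: (@le_trans _ _ (\int[P]_w ((e * n%:R)%:E * (t e w)%:E))%E).
    apply: ge0_le_integral => //.
    - by apply/measurable_EFinP; exact: measurable_indic.
    - by apply/measurable_EFinP; exact: measurable_funM.
    - move=> w _; rewrite -EFinM lee_fin indicE.
      have [wB|_] := boolP (w \in B).
        by rewrite -mulrA; apply: tr_sketched_hat_singular => //; move: wB; rewrite inE.
      rewrite !mulr_ge0 ?(ltW e0)//.
      exact: tr_sketched_hat_ge0 (det_e _ e0) (ltW e0).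
  rewrite ge0_integralZl_EFin//; last 3 first.
  - move=> w _; rewrite lee_fin.
    exact: tr_sketched_hat_ge0 (det_e _ e0) (ltW e0).
  - by apply/measurable_EFinP.
  - by rewrite mulr_ge0// ltW.
  rewrite /K (mulrA e) [leRHS]EFinM; apply: lee_wpmul2l.
    by rewrite lee_fin mulr_ge0// ltW.
  exact: integral_trace_le.
have PB0 : P B = 0%E.
  apply/eqP; rewrite eq_le measure_ge0 andbT.
  apply/lee_addgt0Pr => eps eps0; rewrite add0e.
  have K0 : 0 <= K.
    by have := le_trans (measure_ge0 P B) (PB 1 ltr01); rewrite lee_fin mul1r.
  apply: le_trans (PB (eps / (K + 1)) _) _; first by rewrite divr_gt0//; lra.
  by rewrite lee_fin -mulrA ler_piMr ?(ltW eps0)// mulrC ler_pdivrMr; lra.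
exists B; split => // w /= /negP; rewrite negbK => /eqP; exact.
Qed.

Let ek (k : nat) : R := k.+1%:R^-1.

Let ek_gt0 k : 0 < ek k.
Proof. by rewrite invr_gt0. Qed.

(** Convergence as the regularization vanishes is deduced from differentiability
    at [0], for which the rules on products and inverses are available. *)
Let cvg_at0 (f : R -> R) : derivable f 0 1 -> f (ek k) @[k --> \oo] --> f 0.
Proof.
move=> df; have cf : {for 0, continuous f}.
  exact/differentiable_continuous/derivable1_diffP.
exact: (cvg_comp _ _ (@cvg_harmonic R) cf).
Qed.

Let derivable_N w : nonsingular w -> derivable_mx 0 (fun e => N e w).
Proof.
move=> dw; rewrite /N /sketched_hat; under eq_fun do rewrite hatmxE.
have cst q r (B : 'M[R]_(q, r)) := is_derive_mx_cst 0 B.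
have dQ : is_derive_mx 0 (fun e => (Sm w)^T *m Sm w + e%:M) 1%:M.
  by under eq_fun do rewrite -scalemx1; exact: is_derive_mx_line.
have dA := is_derive_mxM (is_derive_mxM (cst _ _ H^T) dQ) (cst _ _ H).
have [|dV dVE] := derivable_is_derive_mx
  (derivable_adjinv (is_derive_mx_derivable dA) _).
  by rewrite [0%:M]raddf0 addr0.
exact: is_derive_mx_derivable (is_derive_mxM (is_derive_mxM (cst _ _ H) dVE) (cst _ _ H^T)).
Qed.

Let derivable_mxM p q r (A : R -> 'M[R]_(p, q)) (B : R -> 'M[R]_(q, r)) :
  derivable_mx 0 A -> derivable_mx 0 B -> derivable_mx 0 (fun e => A e *m B e).
Proof.
move=> /derivable_is_derive_mx[dA dAE] /derivable_is_derive_mx[dB dBE].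
exact: is_derive_mx_derivable (is_derive_mxM dAE dBE).
Qed.

Let derivable_tr p (A : R -> 'M[R]_p) :
  derivable_mx 0 A -> derivable (fun e => \tr (A e)) 0 1.
Proof. by move=> dA; apply: derivable_sum_seq => i; exact: dA. Qed.

(** For a singular matrix [adjinv] vanishes. *)
Lemma trace0_ge0 w : 0 <= t 0 w.
Proof.
have [det0|det0] := eqVneq (\det (H^T *m ((Sm w)^T *m Sm w + 0%:M) *m H)) 0.
  rewrite /t /N /sketched_hat hatmxE /adjinv det0 invr0 scale0r mulmx0 mul0mx.
  by rewrite linear0.
exact: tr_sketched_hat_ge0.
Qed.

Lemma integrable_trace0 : (d + 1 < m)%N -> P.-integrable setT (EFin \o t 0).
Proof.
move=> dm; apply/integrableP; split; first exact/measurable_EFinP.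
under eq_integral do rewrite /= ger0_norm ?trace0_ge0//.
apply: le_lt_trans (ltry (m%:R * d%:R / (c - 1))).
apply: (@integral_limit_le _ _ _ _ (fun k => t (ek k))) => //.
- move=> k w; exact: tr_sketched_hat_ge0 (det_e _ (ek_gt0 k)) (ltW (ek_gt0 k)).
- apply: filterS (ae_nonsingular dm) => w dw.
  by apply: (@cvg_at0 (t ^~ w)); apply: derivable_tr; exact: derivable_N.
- by move=> k; exact: integral_trace_le.
Qed.

Lemma integrable_sqr_trace0 : (d + 3 < m)%N ->
  P.-integrable setT (fun w => (t 0 w ^+ 2)%:E).
Proof.
move=> dm; apply/integrableP; split.
  by apply/measurable_EFinP; exact: measurable_funX.
under eq_integral do rewrite /= ger0_norm ?sqr_ge0//.
have [C tC] := integral_sqr_trace_le dm.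
apply: le_lt_trans (ltry C).
apply: (@integral_limit_le _ _ _ _ (fun k w => t (ek k) w ^+ 2)) => //.
- move=> k w; exact: sqr_ge0.
- by move=> k; exact: measurable_funX.
- exact: measurable_funX.
- have dm1 : (d + 1 < m)%N by apply: leq_ltn_trans dm; rewrite leq_add2l.
  apply: filterS (ae_nonsingular dm1) => w dw.
  have dt : derivable (t ^~ w) 0 1 by apply: derivable_tr; exact: derivable_N.
  have -> : (fun k => t (ek k) w ^+ 2) = (fun k => (t ^~ w * t ^~ w) (ek k)).
    by apply/funext => k; rewrite expr2.
  by rewrite expr2; exact: cvg_at0 (derivableM dt dt).
- by move=> k; exact: tC.
Qed.

Section Domination.
Variable u : Omega -> R.

(** The constant is uniform in the regularization. *)
Definition uniformly_dominated (F : R -> Omega -> R) :=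
  exists2 K, 0 <= K & forall e w, 0 < e -> nonsingular w -> `|F e w| <= K * u w.

Lemma dominatedD F G : uniformly_dominated F -> uniformly_dominated G ->
  uniformly_dominated (fun e w => F e w + G e w).
Proof.
move=> [K K0 FK] [K' K'0 GK]; exists (K + K') => [|e w e0 dw]; first exact: addr_ge0.
by rewrite mulrDl; apply: le_trans (ler_normD _ _) _; rewrite lerD ?FK ?GK.
Qed.

Lemma dominatedZ (a : R) F : uniformly_dominated F ->
  uniformly_dominated (fun e w => a * F e w).
Proof.
move=> [K K0 FK]; exists (`|a| * K) => [|e w e0 dw]; first exact: mulr_ge0.
by rewrite normrM -mulrA ler_wpM2l ?FK.
Qed.

Lemma dominatedB F G : uniformly_dominated F -> uniformly_dominated G ->
  uniformly_dominated (fun e w => F e w - G e w).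
Proof.
move=> dF [K K0 GK]; apply: dominatedD => //.
by exists K => // e w e0 dw; rewrite normrN GK.
Qed.

(** Dominated convergence along [e = 1/(k+1)]. *)
Lemma dominated_centered (F : R -> Omega -> R) : (d + 1 < m)%N ->
  (forall e, 0 < e -> centered P (F e)) ->
  (forall w, nonsingular w -> derivable (F ^~ w) 0 1) ->
  measurable_fun setT (F 0) -> P.-integrable setT (EFin \o u) ->
  uniformly_dominated F -> centered P (F 0).
Proof.
move=> dm cF dF mF intu [K _ FK].
apply: (@centered_dominated _ _ _ P (fun k => F (ek k)) _ (fun w => K * u w)) => //.
- by move=> k; exact: cF.
- by apply: eq_integrable (integrableZl measurableT K intu).
- by apply: filterS (ae_nonsingular dm) => w dw; exact: (cvg_at0 (dF w dw)).
- by apply: filterS (ae_nonsingular dm) => w dw k; exact: FK.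
Qed.

Hypotheses (u_ge1 : forall w, 1 <= u w) (trace_le_u : forall w, t 0 w <= u w).

Lemma dominated_bounded F (K : R) : 0 <= K ->
  (forall e w, 0 < e -> `|F e w| <= K) -> uniformly_dominated F.
Proof.
move=> K0 FK; exists K => // e w e0 _; apply: le_trans (FK e w e0) _.
by rewrite ler_peMr.
Qed.

Lemma dominated_trace F (K : R) : 0 <= K ->
  (forall e w, 0 < e -> `|F e w| <= K * t e w) -> uniformly_dominated F.
Proof.
move=> K0 FK; exists K => // e w e0 dw; apply: le_trans (FK e w e0) _.
rewrite ler_wpM2l//; apply: le_trans (trace_le_u w).
exact: tr_sketched_hat_mono.
Qed.

Lemma dominated_sqr_trace F (K : R) : (forall w, t 0 w ^+ 2 <= u w) -> 0 <= K ->
  (forall e w, 0 < e -> `|F e w| <= K * t e w ^+ 2) -> uniformly_dominated F.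
Proof.
move=> sqr_le K0 FK; exists K => // e w e0 dw; apply: le_trans (FK e w e0) _.
rewrite ler_wpM2l//; apply: le_trans (sqr_le w).
have t0 : 0 <= t e w := tr_sketched_hat_ge0 (det_e _ e0) (ltW e0).
by rewrite lerXn2r ?nnegrE ?trace0_ge0//; exact: tr_sketched_hat_mono.
Qed.

End Domination.

Section EntryBounds.
Variables (e : R) (w : Omega).
Hypothesis e_gt0 : 0 < e.

Let t_ge0 : 0 <= t e w.
Proof. exact: tr_sketched_hat_ge0 (det_e _ e_gt0) (ltW e_gt0). Qed.

Let mulmx_entry_le (A B : 'M[R]_n) (a b : R) :
  (forall i j, `|A i j| <= a) -> (forall i j, `|B i j| <= b) ->
  forall i j, `|(A *m B) i j| <= n%:R * a * b.
Proof.
move=> Aa Bb i j; rewrite mxE; apply: le_trans (ler_norm_sum _ _ _) _.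
apply: (@le_trans _ _ (\sum_(k < n) a * b)).
  by apply: ler_sum => k _; rewrite normrM ler_pM.
by rewrite sumr_const card_ord -[leLHS]mulr_natl mulrA.
Qed.

Lemma hat_entry_le i j : `|N e w i j| <= t e w.
Proof. exact: sketched_hat_entry (det_e _ e_gt0) (ltW e_gt0) i j. Qed.

Lemma hat2_entry_le i j : `|N2 e w i j| <= n%:R * t e w ^+ 2.
Proof.
have -> : n%:R * t e w ^+ 2 = n%:R * t e w * t e w by ring.
by apply: mulmx_entry_le; exact: hat_entry_le.
Qed.

Lemma hat3_entry_le i j : `|N3 e w i j| <= n%:R ^+ 2 * t e w ^+ 3.
Proof.
have -> : n%:R ^+ 2 * t e w ^+ 3 = n%:R * (n%:R * t e w ^+ 2) * t e w by ring.
by apply: mulmx_entry_le; [exact: hat2_entry_le|exact: hat_entry_le].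
Qed.

Lemma regularized_trace_le : 0 <= e * t e w <= d%:R.
Proof.
rewrite mulr_ge0 ?(ltW e_gt0)//=.
exact: tr_sketched_hat_le (det_e _ e_gt0) (ltW e_gt0).
Qed.

Lemma regularized_trace2_le : 0 <= e * \tr (N2 e w) <= t e w.
Proof.
rewrite mulr_ge0 ?(ltW e_gt0)//=; last exact: tr_sketched_hat2_ge0 (det_e _ e_gt0).
have := mxtrace_gram_ge0 (Sm w *m N e w).
by rewrite (sketched_hat_gram (det_e _ e_gt0)) trB mxtraceZ subr_ge0.
Qed.

End EntryBounds.

Let derivable_entries w i j : nonsingular w ->
  [/\ derivable (fun e => N e w i j) 0 1, derivable (fun e => N2 e w i j) 0 1,
      derivable (fun e => N3 e w i j) 0 1, derivable (t ^~ w) 0 1 &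
      derivable (fun e => \tr (N2 e w)) 0 1].
Proof.
move=> dw; have dN := derivable_N dw.
have dN2 := derivable_mxM dN dN; have dN3 := derivable_mxM dN2 dN.
exact: (And5 (dN i j) (dN2 i j) (dN3 i j) (derivable_tr dN) (derivable_tr dN2)).
Qed.

Let mN2 e : measurable_mx (N2 e).
Proof. exact: measurable_mxM. Qed.

(** The limit of [regularized_first], which is [m Pi - (c - 1) N_0]. *)
Lemma first_moment : (d + 1 < m)%N ->
  centered_mx P (fun w => N 0 w - theta1 R m d *: Pi).
Proof.
move=> dm i j; have m0 : (0 < m)%N by apply: leq_ltn_trans dm.
have c1 : 0 < c - 1 by have := dm; rewrite -(ltr_nat R) natrD; lra.
pose F e w := m%:R * (Pi i j - e * N e w i j)
  - ((c - 1) * N e w i j + e * N2 e w i j + e * t e w * N e w i j).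
pose u w := 1 + t 0 w.
have u1 w : 1 <= u w by rewrite lerDl trace0_ge0.
have ut w : t 0 w <= u w by rewrite lerDr.
have cF : centered P (F 0).
  apply: (@dominated_centered u F dm).
  - by move=> e e0; exact: regularized_first.
  - move=> w dw; have [dN dN2 _ dt _] := derivable_entries i j dw.
    have de : derivable (fun e : R => e) 0 1 by exact: derivable_id.
    have dc (a : R) : derivable (fun=> a : R) (0 : R) 1 by exact: derivable_cst.
    have deN := derivableM de dN; have deN2 := derivableM de dN2.
    have detN := derivableM (derivableM de dt) dN.
    exact: derivableB (derivableM (dc _) (derivableB (dc _) deN))
      (derivableD (derivableD (derivableM (dc _) dN) deN2) detN).
  - rewrite /F; under eq_fun do rewrite !mul0r subr0 !addr0.
    by apply: measurable_funB => //; apply: measurable_funM => //; exact: mN.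
  - have intc : P.-integrable setT (EFin \o (fun=> 1 : R)).
      exact: finite_measure_integrable_cst.
    by apply: eq_integrable (integrableD measurableT intc (integrable_trace0 dm)).
  - apply: dominatedB.
      apply: dominatedZ; apply: dominatedB.
        exact: (dominated_bounded u1 (normr_ge0 (Pi i j))).
      apply: (dominated_bounded u1 (ler0n R d)) => e w e0.
      have /andP[_] := regularized_trace_le w e0; apply: le_trans.
      by rewrite normrM gtr0_norm// ler_wpM2l ?(ltW e0)// hat_entry_le.
    apply: dominatedD; first apply: dominatedD.
    + apply: dominatedZ; apply: (dominated_trace ut ler01) => e w e0.
      by rewrite mul1r hat_entry_le.
    + apply: (dominated_trace ut (_ : 0 <= n%:R * d%:R)) => // e w e0.
      have /andP[_ etd] := regularized_trace_le w e0.
      rewrite normrM gtr0_norm//.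
      apply: le_trans (ler_wpM2l (ltW e0) (hat2_entry_le w e0 i j)) _.
      have -> : e * (n%:R * t e w ^+ 2) = n%:R * (e * t e w) * t e w by ring.
      have t0 := le_trans (normr_ge0 _) (hat_entry_le w e0 i j).
      by rewrite ler_wpM2r// ler_wpM2l.
    + apply: (dominated_trace ut (ler0n R d)) => e w e0.
      have /andP[et0 etd] := regularized_trace_le w e0.
      by rewrite normrM ger0_norm// ler_pM// hat_entry_le.
have := centeredZ (- (c - 1)^-1) cF; congr (centered P _); apply/funext => w.
rewrite /F /theta1 !mul0r !mxE subr0 !addr0.
by field; rewrite gt_eqF.
Qed.

(** The limit of [regularized_second] is
    [m ((c - 1) N_0 + tr N_0 Pi) - c (c - 3) N_0^2]; the first moment evaluates
    the terms of degree one. *)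
Lemma second_moment : (d + 3 < m)%N ->
  centered_mx P (fun w => N2 0 w - theta2 R m d *: Pi).
Proof.
move=> dm i j; have m0 : (0 < m)%N by apply: leq_ltn_trans dm.
have dm1 : (d + 1 < m)%N by apply: leq_ltn_trans dm; rewrite leq_add2l.
have c3 : 0 < c - 3 by have := dm; rewrite -(ltr_nat R) natrD; lra.
pose F e w :=
  m%:R * ((c - 1) * (N e w i j - e * N2 e w i j) + t e w * (Pi i j - e * N e w i j))
  - (c * (c - 3) * N2 e w i j + 2 * c * (e * N3 e w i j) + c * (e * t e w * N2 e w i j)
     + (c - 1) * (e * \tr (N2 e w) * N e w i j) + e * t e w * t e w * N e w i j).
pose u w := 1 + t 0 w ^+ 2.
have u1 w : 1 <= u w by rewrite lerDl sqr_ge0.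
have ut w : t 0 w <= u w by have := sqr_ge0 (t 0 w - 1); rewrite /u; nra.
have us w : t 0 w ^+ 2 <= u w by rewrite lerDr.
have cF : centered P (F 0).
  apply: (@dominated_centered u F dm1).
  - by move=> e e0; exact: regularized_second.
  - move=> w dw; have [dN dN2 dN3 dt dt2] := derivable_entries i j dw.
    have de : derivable (fun e : R => e) 0 1 by exact: derivable_id.
    have dc (a : R) : derivable (fun=> a : R) (0 : R) 1 by exact: derivable_cst.
    have deN := derivableM de dN; have deN2 := derivableM de dN2.
    have deN3 := derivableM de dN3; have det := derivableM de dt.
    have dlhs := derivableD (derivableM (dc (c - 1)) (derivableB dN deN2))
      (derivableM dt (derivableB (dc (Pi i j)) deN)).
    have drhs := derivableD (derivableD (derivableD (derivableD
      (derivableM (dc (c * (c - 3))) dN2) (derivableM (dc (2 * c)) deN3))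
      (derivableM (dc c) (derivableM det dN2)))
      (derivableM (dc (c - 1)) (derivableM (derivableM de dt2) dN)))
      (derivableM (derivableM det dt) dN).
    exact: derivableB (derivableM (dc m%:R) dlhs) drhs.
  - rewrite /F; under eq_fun do rewrite !mul0r !mulr0 !subr0 !addr0.
    apply: measurable_funB; apply: measurable_funM => //; last exact: mN2.
    apply: measurable_funD; apply: measurable_funM => //; exact: mN.
  - have intc : P.-integrable setT (EFin \o (fun=> 1 : R)).
      exact: finite_measure_integrable_cst.
    by apply: eq_integrable (integrableD measurableT intc (integrable_sqr_trace0 dm)).
  - have eN2_le e w : 0 < e -> `|e * N2 e w i j| <= n%:R * d%:R * t e w.
      move=> e0; have /andP[_ etd] := regularized_trace_le w e0.
      rewrite normrM gtr0_norm//.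
      apply: le_trans (ler_wpM2l (ltW e0) (hat2_entry_le w e0 i j)) _.
      have -> : e * (n%:R * t e w ^+ 2) = n%:R * (e * t e w) * t e w by ring.
      have t0 := le_trans (normr_ge0 _) (hat_entry_le w e0 i j).
      by rewrite ler_wpM2r// ler_wpM2l.
    have eN_le e w : 0 < e -> `|e * N e w i j| <= d%:R.
      move=> e0; have /andP[_] := regularized_trace_le w e0; apply: le_trans.
      by rewrite normrM gtr0_norm// ler_wpM2l ?(ltW e0)// hat_entry_le.
    have nd0 : 0 <= n%:R * d%:R :> R by [].
    have dN : uniformly_dominated u (fun e w => N e w i j).
      by apply: (dominated_trace ut ler01) => e w e0; rewrite mul1r hat_entry_le.
    apply: dominatedB; first apply: dominatedZ.
      apply: dominatedD; first apply: dominatedZ.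
        by apply: dominatedB => //; exact: (dominated_trace ut nd0).
      apply: (dominated_trace ut (_ : 0 <= `|Pi i j| + d%:R)) => [|e w e0].
        by rewrite addr_ge0.
      have t0 := le_trans (normr_ge0 _) (hat_entry_le w e0 i j).
      rewrite normrM ger0_norm// mulrC ler_wpM2r//.
      by apply: le_trans (ler_normB _ _) _; rewrite lerD2l eN_le.
    apply: dominatedD; first apply: dominatedD; first apply: dominatedD;
      first apply: dominatedD; try apply: dominatedZ.
    + by apply: (dominated_sqr_trace us (ler0n R n)) => e w e0; exact: hat2_entry_le.
    + apply: (dominated_sqr_trace us (_ : 0 <= n%:R ^+ 2 * d%:R)) => [|e w e0].
        by rewrite mulr_ge0// exprn_ge0.
      have /andP[_ etd] := regularized_trace_le w e0.
      rewrite normrM gtr0_norm//.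
      apply: le_trans (ler_wpM2l (ltW e0) (hat3_entry_le w e0 i j)) _.
      have -> : e * (n%:R ^+ 2 * t e w ^+ 3) =
        n%:R ^+ 2 * (e * t e w) * t e w ^+ 2 by ring.
      by rewrite ler_wpM2r ?sqr_ge0// ler_wpM2l// exprn_ge0.
    + apply: (dominated_sqr_trace us (_ : 0 <= d%:R * n%:R)) => // e w e0.
      have /andP[et0 etd] := regularized_trace_le w e0.
      by rewrite normrM ger0_norm// -[leRHS]mulrA ler_pM// hat2_entry_le.
    + apply: (dominated_sqr_trace us ler01) => e w e0.
      have /andP[et0 etd] := regularized_trace2_le w e0.
      by rewrite normrM ger0_norm// mul1r expr2 ler_pM// hat_entry_le.
    + apply: (dominated_sqr_trace us (ler0n R d)) => e w e0.
      have /andP[et0 etd] := regularized_trace_le w e0.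
      have t0 := le_trans (normr_ge0 _) (hat_entry_le w e0 i j).
      have ett0 : 0 <= e * t e w * t e w by rewrite mulr_ge0.
      have -> : d%:R * t e w ^+ 2 = d%:R * t e w * t e w by ring.
      by rewrite normrM ger0_norm// ler_pM ?hat_entry_le// ler_wpM2r.
have c_gt0 : 0 < c by lra.
have c1 : 0 < c - 1 by lra.
have cfirst := first_moment dm1.
have ct : centered P (fun w => t 0 w - theta1 R m d * d%:R).
  have := centered_mxtrace cfirst; congr (centered P _); apply/funext => w.
  by rewrite trB mxtraceZ mxtrace_hat1.
have := centeredD (centeredZ (- (c * (c - 3))^-1) cF) (centeredD
  (centeredZ (m%:R * (c - 1) / (c * (c - 3))) (cfirst i j))
  (centeredZ (m%:R * Pi i j / (c * (c - 3))) ct)).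
congr (centered P _); apply/funext => w.
rewrite /F /theta1 /theta2 !mul0r.
move: (N2 0 w) (N3 0 w) (N 0 w) (t 0 w) => y z x tt; rewrite !mxE.
have e3 : c - 3 != 0 by rewrite gt_eqF.
have e1 : c - 1 != 0 by rewrite gt_eqF.
have e0 : c != 0 by rewrite gt_eqF.
by field; rewrite ?e0 ?e1 ?e3.
Qed.

End InverseMoments.

(** * Bias and variance of the sketched direction *)

Section DirectionError.
Local Open Scope classical_set_scope.
Context {disp : measure_display} {Omega : measurableType disp} {R : realType}.
Variables (P : probability Omega R) (m n d : nat).
Variables (H : 'M[R]_(n, d)) (g : 'cV[R]_d) (S : 'I_m -> 'I_n -> {RV P >-> R}).
Hypothesis full_rank : \rank H = d.
Hypothesis gaussS : gaussian_sketch S.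

Local Notation Pi := (hatmx H 1%:M).
Let N0 w := sketched_hat H 0 (sketch_mx S w).
Let u : 'cV[R]_n := H *m newton_direction H g.

Let Pi_u : Pi *m u = u.
Proof. by rewrite /u mulmxA hat1_mul_im. Qed.

Let trH_u : H^T *m u = g.
Proof.
have := hat1_det full_rank; rewrite mulmx1 => detK.
by rewrite /u /newton_direction !mulmxA mulmxV ?mul1mx// unitmxE unitfE.
Qed.

Lemma direction_errorE alpha w :
  \det (H^T *m ((sketch_mx S w)^T *m sketch_mx S w) *m H) != 0 ->
  direction_error H g S alpha w = alpha *: (N0 w *m u) - u.
Proof.
move=> detW; rewrite /direction_error /sketched_direction mulmxBr -scalemxAr.
congr (_ *: _ - _); rewrite /N0 /sketched_hat hatmxE [0%:M]raddf0 addr0.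
by rewrite adjinvE// -!mulmxA trH_u !mulmxA.
Qed.

Lemma measurable_direction_error alpha :
  measurable_mx (direction_error H g S alpha).
Proof.
have mS := measurable_sketch_mx S.
rewrite /direction_error; apply: measurable_mxM; first exact: measurable_mx_cst.
rewrite /sketched_direction; apply: measurable_mxD; last exact: measurable_mx_cst.
apply: measurable_mxZ; first exact: measurable_cst.
apply: measurable_mxM; last exact: measurable_mx_cst.
apply: measurable_invmx.
apply: measurable_mxM; last exact: measurable_mx_cst.
apply: measurable_mxM => //.
by apply: measurable_mxM; [exact: measurable_mx_cst|exact: measurable_mx_tr].
Qed.

Lemma direction_bias_eq0 : (d + 1 < m)%N ->
  direction_bias H g S (theta1 R m d)^-1 = const_mx 0%E.
Proof.
move=> dm; have c1 : 0 < m%:R - d%:R - 1 :> R.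
  by have := dm; rewrite -(ltr_nat R) natrD; lra.
have th0 : theta1 R m d != 0.
  rewrite mulf_neq0// ?invr_eq0 ?gt_eqF// ltr0n; exact: leq_ltn_trans dm.
have cN := centered_mulmxr u (first_moment full_rank gaussS dm).
apply/matrixP => i j; rewrite !mxE unlock ord1.
have cX := centeredZ (theta1 R m d)^-1 (cN i 0).
have [_ <-] := cX; apply: ae_eq_integral => //.
- by apply/measurable_EFinP; exact: measurable_direction_error.
- by apply/measurable_EFinP; exact: centered_measurable cX.
- apply: filterS (ae_nonsingular full_rank gaussS dm) => w dw _.
  rewrite direction_errorE// mulmxBl -scalemxAl Pi_u -/(N0 w).
  by move: (N0 w *m u) => y; rewrite !mxE; congr (_%:E); field.
Qed.

Lemma direction_varianceE alpha : (d + 3 < m)%N ->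
  direction_variance H g S alpha =
  ((alpha ^+ 2 * theta2 R m d - 2 * alpha * theta1 R m d + 1) * l2norm u ^+ 2)%:E.
Proof.
move=> dm; have dm1 : (d + 1 < m)%N by apply: leq_ltn_trans dm; rewrite leq_add2l.
have l2E (v : 'cV[R]_n) : l2norm v ^+ 2 = (v^T *m v) 0 0.
  rewrite /l2norm sqr_sqrtr; last by apply: sumr_ge0 => i _; exact: sqr_ge0.
  by rewrite mxE; apply: eq_bigr => i _; rewrite mxE expr2.
have quad (F : Omega -> 'M[R]_n) : centered_mx P F ->
    centered P (fun w => (u^T *m F w *m u) 0 0).
  move=> cF; have := centered_mulmxr u (centered_mulmxl u^T cF).
  exact.
have c1 := quad _ (first_moment full_rank gaussS dm1).
have c2 := quad _ (second_moment full_rank gaussS dm).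
have cX := centeredD (centeredZ (alpha ^+ 2) c2) (centeredZ (- (2 * alpha)) c1).
rewrite -(integral_cst_centered _ cX) /direction_variance unlock.
apply: ae_eq_integral => //.
- apply/measurable_EFinP; under eq_fun do rewrite l2E mxE.
  apply: measurable_sum => i; apply: measurable_funM.
    exact: measurable_mx_tr (measurable_direction_error alpha) _ _.
  exact: measurable_direction_error.
- by apply/measurable_EFinP; apply: measurable_funD => //; exact: centered_measurable cX.
- apply: filterS (ae_nonsingular full_rank gaussS dm1) => w dw _.
  rewrite direction_errorE// !l2E; congr (_%:E); rewrite -/(N0 w).
  have NT : (N0 w)^T = N0 w.
    by apply: trmx_sketched_hat; rewrite [0%:M]raddf0 addr0.
  have -> : (alpha *: (N0 w *m u) - u)^T *m (alpha *: (N0 w *m u) - u) =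
      alpha ^+ 2 *: (u^T *m (N0 w *m N0 w) *m u) - (2 * alpha) *: (u^T *m N0 w *m u)
      + u^T *m u.
    rewrite [(_ - _)^T]raddfB/= [(alpha *: _)^T]linearZ/= [(N0 w *m u)^T]trmx_mul NT.
    rewrite mulmxBl !mulmxBr -!scalemxAl -!scalemxAr !mulmxA.
    move: (u^T *m N0 w *m N0 w *m u) (u^T *m N0 w *m u) (u^T *m u) => x y z.
    by apply/matrixP => a b; rewrite !mxE; ring.
  rewrite !mulmxBr !mulmxBl -!scalemxAr -!scalemxAl -(mulmxA _ Pi) Pi_u.
  move: (u^T *m (N0 w *m N0 w) *m u) (u^T *m N0 w *m u) (u^T *m u) => x y z.
  by rewrite !mxE; ring.
Qed.

End DirectionError.

Unset Implicit Arguments.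

Theorem theoremV1 (R : realType) (disp : measure_display)
    (Omega : measurableType disp) (P : probability Omega R)
    (m n d : nat) (H : 'M[R]_(n, d)) (g : 'cV[R]_d)
    (S : 'I_m -> 'I_n -> {RV P >-> R})
    (le_dn : (d <= n)%N)
    (full_rank : \rank H = d)
    (gaussS : gaussian_sketch S) :
  ((d + 3 < m)%N ->
     forall alpha : R,
       (direction_variance H g S (theta1 R m d / theta2 R m d)
          <= direction_variance H g S alpha)%E) /\
  ((d + 1 < m)%N ->
     direction_bias H g S (theta1 R m d)^-1 = const_mx 0%E).
Proof.
split; last exact: direction_bias_eq0.
move=> dm alpha; rewrite !direction_varianceE// lee_fin.
rewrite ler_wpM2r ?sqr_ge0//.
have th2 : 0 < theta2 R m d.
  have := dm; rewrite -(ltr_nat R) natrD => dm'; have := ler0n R d => d0.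
  by rewrite divr_gt0 ?mulr_gt0 ?exprn_gt0//; lra.
rewrite -subr_ge0.
have -> : alpha ^+ 2 * theta2 R m d - 2 * alpha * theta1 R m d + 1 -
    ((theta1 R m d / theta2 R m d) ^+ 2 * theta2 R m d -
     2 * (theta1 R m d / theta2 R m d) * theta1 R m d + 1) =
    (alpha * theta2 R m d - theta1 R m d) ^+ 2 / theta2 R m d.
  by field; rewrite gt_eqF.
by rewrite divr_ge0 ?sqr_ge0// ltW.
Qed.
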